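(* Let $\theta\ge4$ be an integer, let $\mathcal C=\mathcal C(I,A,(\rho_i)_{i\in I},(C^a)_{a\in A})$ be a connected Cartan scheme with $I=\{1,2,\dots,\theta\}$ and $|A|=3$, and let $\mathcal R=\mathcal R(\mathcal C,(R^a)_{a\in A})$ be a finite irreducible root system of type $\mathcal C$. Then $\mathcal R$ is standard, and the common Cartan matrix $C$ is indecomposable and of type $B_4$, $C_4$, $D_4$ or $F_4$. Moreover, after a suitable permutation of $I$ and enumeration $A=\{x,y,z\}$, the maps $\rho_i$ are as follows: if $C$ is of type $B_4$ or $C_4$, then $\rho_1,\rho_3$ interchange $x,y$ and fix $z$, $\rho_2$ interchanges $y,z$ and fixes $x$, and $\rho_4=\mathrm{id}$; if $C$ is of type $D_4$, then $\rho_1,\rho_3,\rho_4$ interchange $x,y$ and fix $z$, and $\rho_2$ interchanges $y,z$ and fixes $x$; if $C$ is of type $F_4$, then $\rho_1$ interchanges $x,y$ and fixes $z$, $\rho_2$ interchanges $y,z$ and fixes $x$, and $\rho_3=\rho_4=\mathrm{id}$.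
   Context: Let $I$ be a nonempty finite set and $\{\alpha_i\mid i\in I\}$ the standard basis of $\mathbb Z^I$; $\mathbb N_0=\{0,1,2,\dots\}$. A generalized Cartan matrix is $C=(c_{ij})_{i,j\in I}\in\mathbb Z^{I\times I}$ with $c_{ii}=2$, $c_{jk}\le0$ for $j\ne k$, and $c_{ij}=0\Rightarrow c_{ji}=0$. A Cartan scheme $\mathcal C=\mathcal C(I,A,(\rho_i)_{i\in I},(C^a)_{a\in A})$ consists of a nonempty set $A$, maps $\rho_i:A\to A$ and generalized Cartan matrices $C^a=(c^a_{jk})_{j,k\in I}$ such that (C1) $\rho_i^2=\mathrm{id}$ and (C2) $c^a_{ij}=c^{\rho_i(a)}_{ij}$ for all $a\in A$, $i,j\in I$. It is connected if the group generated by the $\rho_i$ acts transitively on $A$; it is standard if $C^a=C^b$ for all $a,b\in A$ (a root system is standard if its Cartan scheme is). For $i\in I$, $a\in A$ let $\sigma_i^a\in\mathrm{Aut}(\mathbb Z^I)$, $\sigma_i^a(\alpha_j)=\alpha_j-c^a_{ij}\alpha_i$. A root system of type $\mathcal C$ is a family $\mathcal R=\mathcal R(\mathcal C,(R^a)_{a\in A})$ of subsets $R^a\subset\mathbb Z^I$ such that, writing $R^a_+=R^a\cap\mathbb N_0^I$ and $m^a_{i,j}=|R^a\cap(\mathbb N_0\alpha_i+\mathbb N_0\alpha_j)|$, for all $a\in A$, $i,j\in I$: (R1) $R^a=R^a_+\cup(-R^a_+)$; (R2) $R^a\cap\mathbb Z\alpha_i=\{\alpha_i,-\alpha_i\}$;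 (R3) $\sigma_i^a(R^a)=R^{\rho_i(a)}$; (R4) if $i\neq j$ and $m^a_{i,j}$ is finite then $(\rho_i\rho_j)^{m^a_{i,j}}(a)=a$. It is finite if every $R^a$ is finite. $\mathcal R$ is reducible if there exist nonempty disjoint $I_1,I_2\subset I$ with $I=I_1\cup I_2$ and $R^a=(R^a\cap\sum_{i\in I_1}\mathbb Z\alpha_i)\cup(R^a\cap\sum_{j\in I_2}\mathbb Z\alpha_j)$ for all $a\in A$; otherwise it is irreducible. *)

(* Defs.v *)
From HB Require Import structures.
From mathcomp Require Import all_boot all_order all_algebra.
Set Implicit Arguments. Unset Strict Implicit. Unset Printing Implicit Defensive.
Import Order.TTheory GRing.Theory Num.Theory.
Local Open Scope ring_scope.

Section Defs.
Variable n : nat.       (* I = 'I_n, i.e. {1,...,n} shifted to {0,...,n-1} *)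
Variable A : finType.

Definition alpha (i : 'I_n) : 'rV[int]_n := delta_mx 0 i.

Definition gcm (M : 'M[int]_n) : Prop :=
  (forall i, M i i = 2) /\
  (forall j k, j != k -> M j k <= 0) /\
  (forall i j, M i j = 0 -> M j i = 0).

Definition cartan_scheme (rho : 'I_n -> A -> A) (C : A -> 'M[int]_n) : Prop :=
  (forall a, gcm (C a)) /\
  (forall i a, rho i (rho i a) = a) /\
  (forall a i j, C a i j = C (rho i a) i j).

(* the group generated by the rho_i acts transitively on A
   (the rho_i are involutions, so words in the rho_i suffice) *)
Definition connected_scheme (rho : 'I_n -> A -> A) : Prop :=
  forall a b : A, exists w : seq 'I_n, foldr (fun i x => rho i x) a w = b.

Definition standard_scheme (C : A -> 'M[int]_n) : Prop :=
  forall a b, C a = C b.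

(* sigma_i^a : alpha_j |-> alpha_j - c^a_ij alpha_i, extended linearly *)
Definition sigma (C : A -> 'M[int]_n) (i : 'I_n) (a : A) (v : 'rV[int]_n)
  : 'rV[int]_n :=
  v - (\sum_(j < n) C a i j * v 0 j) *: alpha i.

Definition nonneg (v : 'rV[int]_n) : Prop := forall j, 0 <= v 0 j.

Definition in_cone (i j : 'I_n) (v : 'rV[int]_n) : Prop :=
  exists k l : nat, v = alpha i *+ k + alpha j *+ l.

Definition root_system (rho : 'I_n -> A -> A) (C : A -> 'M[int]_n)
  (R : A -> 'rV[int]_n -> Prop) : Prop :=
  (forall a v, R a v <-> ((R a v /\ nonneg v) \/ (R a (- v) /\ nonneg (- v)))) /\
  (forall a i v, (R a v /\ exists k : int, v = k *: alpha i) <->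
                 (v = alpha i \/ v = - alpha i)) /\
  (forall a i w, R (rho i a) w <-> exists v, R a v /\ sigma C i a v = w) /\
  (* (R4) if i <> j and m^a_ij is finite (= size of a duplicate-free
     enumeration s of R^a n (N0 alpha_i + N0 alpha_j)), then
     (rho_i rho_j)^(m^a_ij) a = a *)
  (forall a i j, i != j ->
     forall s : seq 'rV[int]_n, uniq s ->
       (forall v, v \in s <-> (R a v /\ in_cone i j v)) ->
       iter (size s) (fun b => rho i (rho j b)) a = a).

Definition finite_rs (R : A -> 'rV[int]_n -> Prop) : Prop :=
  forall a, exists s : seq 'rV[int]_n, forall v, R a v -> v \in s.

Definition supported_in (I1 : {set 'I_n}) (v : 'rV[int]_n) : Prop :=
  forall j, j \notin I1 -> v 0 j = 0.

Definition reducible_rs (R : A -> 'rV[int]_n -> Prop) : Prop :=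
  exists I1 : {set 'I_n}, I1 != set0 /\ ~: I1 != set0 /\
    forall a v, R a v -> supported_in I1 v \/ supported_in (~: I1) v.

Definition irreducible_rs (R : A -> 'rV[int]_n -> Prop) : Prop :=
  ~ reducible_rs R.

Definition indecomposable (M : 'M[int]_n) : Prop :=
  ~ exists I1 : {set 'I_n}, I1 != set0 /\ ~: I1 != set0 /\
      forall i j, i \in I1 -> j \notin I1 -> M i j = 0.

End Defs.

(* Cartan matrices of rank 4, Bourbaki labelling of the nodes (node k is
   index k-1), convention sigma_i(alpha_j) = alpha_j - c_ij alpha_i,
   c_ij = <alpha_i^vee, alpha_j>. *)
Definition cmB4 (i j : nat) : int :=
  match i, j with
  | 0, 0 | 1, 1 | 2, 2 | 3, 3 => 2
  | 0, 1 | 1, 0 | 1, 2 | 2, 1 | 2, 3 => -1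
  | 3, 2 => -2
  | _, _ => 0
  end.
Definition cmC4 (i j : nat) : int := cmB4 j i.
Definition cmD4 (i j : nat) : int :=
  match i, j with
  | 0, 0 | 1, 1 | 2, 2 | 3, 3 => 2
  | 0, 1 | 1, 0 | 1, 2 | 2, 1 | 1, 3 | 3, 1 => -1
  | _, _ => 0
  end.
Definition cmF4 (i j : nat) : int :=
  match i, j with
  | 0, 0 | 1, 1 | 2, 2 | 3, 3 => 2
  | 0, 1 | 1, 0 | 1, 2 | 2, 3 | 3, 2 => -1
  | 2, 1 => -2
  | _, _ => 0
  end.
(* the same Dynkin diagram F4 with the double bond oriented the other way *)
Definition cmF4' (i j : nat) : int := cmF4 j i.

Definition swaps (A : finType) (r : A -> A) (u v w : A) : Prop :=
  r u = v /\ r v = u /\ r w = w.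

(* Main.v *)
(** The sums [d_a] of the positive roots at the objects [a] satisfy
    [sigma_i (d_a - alpha_i) = d_(rho_i a) - alpha_i], because [sigma_i] permutes
    the positive roots other than [alpha_i]; the same holds, for [i] in [J], for
    the positive roots supported in a set [J] of nodes. In coordinates these are
    linear equations with positive solutions, which replace the criterion of
    Vinberg for Cartan matrices of finite type. Averaged over all objects they
    show that the entrywise minimum of the Cartan matrices is of finite type.

    By connectedness some node exchanges [x, y] and another one [y, z], and by
    (R4) such nodes are always joined. The equations for three nodes, with the
    cases [m = 2, 3, 4] of (R4), show that two such nodes are joined by a
    constant simple edge as soon as one of them has a further neighbour, that
    nodes acting by the same transposition are not joined, and that a node
    fixing all objects is joined to at most one of the two, by a constant double
    edge. Thus the moving nodes form a star of simple edges, and the finite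
    diagrams that can grow from it are those of types [B4], [C4], [D4], [F4],
    as anything larger contains an affine diagram. *)
Require Import Defs.
From mathcomp Require Import all_boot all_order all_algebra.
From mathcomp Require Import zify ring.
From Stdlib Require Import Classical.
Set Implicit Arguments. Unset Strict Implicit. Unset Printing Implicit Defensive.
Import Order.TTheory GRing.Theory Num.Theory.

(** * Linear equations for root sums *)

(** Replaces the product of an entry and a coordinate by a linear bound, exact for small entries.
    The systems below thereby become linear in each case, and [lia] decides them. *)
Lemma one_or_more (e d : nat) : 0 < e ->
  e = 1 /\ e * d = d \/ 2 <= e /\ 2 * d <= e * d.
Proof.
case: e => [|[|e]] // _; [left | right; split=> //; exact: leq_mul].
by rewrite mul1n.
Qed.

Lemma one_or_more_but_two (Q : Prop) (e d : nat) : 0 < e -> (Q -> e <> 2) ->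
  e = 1 /\ e * d = d \/ [/\ 2 <= e, 2 * d <= e * d & Q -> 3 * d <= e * d].
Proof.
case: e => [|[|[|e]]] // _ Q2; [by rewrite mul1n; left | right.. ].
  by split=> // q; case: Q2.
by split=> // *; apply: leq_mul.
Qed.

Lemma one_or_two_or_more (e d : nat) : 0 < e ->
  e = 1 /\ e * d = d \/ e = 2 /\ e * d = 2 * d \/ 3 <= e /\ 3 * d <= e * d.
Proof.
case: e => [|[|[|e]]] // _; [left | right; left | right; right; split=> //; exact: leq_mul].
  by rewrite mul1n.
by [].
Qed.

(** Entries of an edge between a moving and a fixing node: [f] in the row of the moving node, shared
    by the two exchanged objects, and [h], [h'] in the row of the fixing node at these objects. The
    case of two entries 1 is missing, since (R4) with m = 3 would force the moving node to fix the
    object. *)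
Definition edge_mv (f h h' : nat) :=
  [/\ f = 0, h = 0 & h' = 0] \/ [/\ f = 1, 2 <= h & 2 <= h'] \/ [/\ 2 <= f, 0 < h & 0 < h'].
Definition edge_fx (f h : nat) := f = 0 /\ h = 0 \/ 0 < f /\ 0 < h.

Lemma edge_mv_mul f h h' d d1 d2 : edge_mv f h h' ->
  [/\ f = 0, f * d = 0, h * d1 = 0 & h' * d2 = 0] \/
  [/\ f = 1, f * d = d, 2 * d1 <= h * d1 & 2 * d2 <= h' * d2] \/
  [/\ 2 <= f, 2 * d <= f * d, d1 <= h * d1 & d2 <= h' * d2].
Proof.
case=> [[-> -> ->]|[[-> h1 h2]|[f2 h1 h2]]]; [by left | right; left | right; right].
  by rewrite mul1n; split=> //; apply: leq_mul.
by split=> //; rewrite ?leq_pmull //; apply: leq_mul.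
Qed.

Lemma edge_fx_mul f h d d1 : edge_fx f h ->
  [/\ f = 0, f * d = 0 & h * d1 = 0] \/ [/\ 0 < f, d <= f * d & d1 <= h * d1].
Proof. by case=> [[-> ->]|[f0 h0]]; [left | right; rewrite !leq_pmull]. Qed.

(* In the following lemmas the capital letters and [u], [v], [w] stand for the
   coordinates of root sums at three objects [x], [y], [z], and the remaining
   variables for absolute values of entries of Cartan matrices. The types 1, 2
   and e of the nodes mean: exchanging [x] and [y], exchanging [y] and [z],
   fixing all objects. *)
Lemma entries_12e (p q r s f f' g g' hx hy hz lx ly lz u u' w w' D : nat) :
  0 < u -> 0 < u' -> 0 < w -> 0 < w' -> 0 < D ->
  0 < p -> 0 < q -> 0 < r -> 0 < s ->
  u + u' = 2 + (p * w + f * D) -> u' + u' = 2 + (r * w' + f' * D) ->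
  w + w' = 2 + (q * u' + g * D) -> w + w = 2 + (s * u + g' * D) ->
  D + D = 2 + (hx * u + lx * w) -> D + D = 2 + (hy * u' + ly * w) ->
  D + D = 2 + (hz * u' + lz * w') ->
  (p = 1 -> q = 1 -> r = 1 /\ s = 1) -> (p = 1 -> s = 1 -> q = 1) ->
  (q = 1 -> r = 1 -> p = 1) ->
  edge_mv f hx hy -> edge_fx f' hz -> edge_mv g ly lz -> edge_fx g' lx ->
  [/\ f = 0, f' = 0, g = 0 & g' = 0] \/
  [/\ p = 1, q = 1, r = 1 & s = 1] /\
   ([/\ g = 0, g' = 0, 0 < f & 0 < f'] \/ [/\ f = 0, f' = 0, 0 < g & 0 < g']).
Proof.
move=> u0 u0' w0 w0' D0 p0 q0 r0 s0 e1 e2 e3 e4 e5 e6 e7 a1 a2 a3 ef ef' eg eg'.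
have {ef} := edge_mv_mul D u u' ef.
have {ef'} := edge_fx_mul D u' ef'.
have {eg} := edge_mv_mul D w w' eg.
have {eg'} := edge_fx_mul D w eg'.
have := one_or_more w p0; have := one_or_more u' q0.
have := one_or_more w' r0; have := one_or_more u s0.
move=> {p0 q0 r0 s0}.
move: e1 e2 e3 e4 e5 e6 e7.
move: (p * w) (q * u') (r * w') (s * u) (f * D) (f' * D) => P Q R S F F'.
move: (g * D) (g' * D) (hx * u) (hy * u') (hz * u') (lx * w) (ly * w) (lz * w').
move=> G G' Hx Hy Hz Lx Ly Lz e1 e2 e3 e4 e5 e6 e7.
case=> [[s1 S1]|[s2 S2]]; case=> [[r1 R1]|[r2 R2]]; case=> [[q1 Q1]|[q2 Q2]];
case=> [[p1 P1]|[p2 P2]]; try (exfalso; lia); move=> {a1 a2 a3};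
case=> [[g'0 G'0 lx0]|[g'0 bg' blx]]; case=> [[g0 G0 ly0 lz0]|[[g0 bg bly blz]|[g0 bg bly blz]]];
try (exfalso; lia);
case=> [[f'0 F'0 hz0]|[f'0 bf' bhz]]; case=> [[f0 F0 hx0 hy0]|[[f0 bf bhx bhy]|[f0 bf bhx bhy]]];
try (exfalso; lia).
all: first [by left | by right; split=> //; left; split=> //; lia
  | by right; split=> //; right; split=> //; lia].
Qed.

(** Two nodes of type 1 with coordinates [u], [v] and one of type 2 with coordinate [w], or [w'] at
    [z]. The entries [p], [r] are in the row of the first node at [x], [z], and [s], [q] in the row
    of the type 2 node at [x], [y]; their primed versions belong to the second node. The pairs [l],
    [m] and [l'], [m'] join the two nodes of type 1 at [x] and [z]. *)
Lemma entries_112 (p q r s p' q' r' s' l m l' m' u v w w' : nat) :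
  0 < u -> 0 < v -> 0 < w -> 0 < w' ->
  0 < p -> 0 < q -> 0 < r -> 0 < s ->
  0 < p' -> 0 < q' -> 0 < r' -> 0 < s' ->
  u + u = 2 + (p * w + l * v) -> u + u = 2 + (r * w' + l' * v) ->
  v + v = 2 + (p' * w + m * u) -> v + v = 2 + (r' * w' + m' * u) ->
  w + w' = 2 + (q * u + q' * v) -> w + w = 2 + (s * u + s' * v) ->
  (p = 1 -> q = 1 -> r = 1 /\ s = 1) -> (p = 1 -> s = 1 -> q = 1) ->
  (q = 1 -> r = 1 -> p = 1) ->
  (p = 1 -> s <> 2) -> (q = 1 -> r <> 2) ->
  (p' = 1 -> s' <> 2) -> (q' = 1 -> r' <> 2) ->
  edge_fx l m -> edge_fx l' m' ->
  [/\ p = 1, q = 1, r = 1 & s = 1] /\ l = 0 /\ l' = 0.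
Proof.
move=> u0 v0 w0 w0' p0 q0 r0 s0 p0' q0' r0' s0' e1 e2 e3 e4 e5 e6.
move=> a1 a2 a3 a4 a5 b4 b5 el el'.
have := edge_fx_mul v u el; have := edge_fx_mul v u el'.
have := one_or_more v q0'; have := one_or_more_but_two w' r0' b5.
have := one_or_more w p0'; have := one_or_more_but_two v s0' b4.
have := one_or_more u q0; have := one_or_more_but_two w' r0 a5.
have := one_or_more w p0; have := one_or_more_but_two u s0 a4.
move=> {a4 a5 b4 b5 el el' p0 q0 r0 s0 p0' q0' r0' s0'}.
move: e1 e2 e3 e4 e5 e6; move: (p * w) (q * u) (r * w') (s * u) => P Q R S.
move: (p' * w) (q' * v) (r' * w') (s' * v) (l * v) (m * u) => P' Q' R' S' L M.
move: (l' * v) (m' * u) => L' M' e1 e2 e3 e4 e5 e6.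
case=> [[s1 S1]|[s2 S2 S3]]; case=> [[p1 P1]|[p2 P2]];
case=> [[r1 R1]|[r2 R2 R3]]; case=> [[q1 Q1]|[q2 Q2]]; try (exfalso; lia).
all: first [have {}S3 := S3 p1 | clear S3 | idtac]; first [have {}R3 := R3 q1 | clear R3 | idtac].
all: move=> {a1 a2 a3}.
all: case=> [[s1' S1']|[s2' S2' S3']]; case=> [[p1' P1']|[p2' P2']]; try (exfalso; lia).
all: case=> [[r1' R1']|[r2' R2' R3']]; case=> [[q1' Q1']|[q2' Q2']]; try (exfalso; lia).
all: case=> [[l0' L0' m0']|[lp' bl' bm']]; case=> [[l0 L0 m0]|[lp bl bm]];
  try (exfalso; lia); subst.
all: by [].
Qed.

(** Continues [entries_12e] when the edge between types 1 and 2 is simple and the fixing node is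
    joined to type 1 only. The bounds relating [hx] and [hy] come from [cart121_le] and
    [cart212_le]. *)
Lemma entries_12e_const (f f' hx hy hz u u' w w' D : nat) :
  0 < u -> 0 < u' -> 0 < w -> 0 < w' -> 0 < D ->
  u + u' = 2 + (w + f * D) -> u' + u' = 2 + (w' + f' * D) ->
  w + w' = 2 + u' -> w + w = 2 + u ->
  D + D = 2 + hx * u -> D + D = 2 + hy * u' -> D + D = 2 + hz * u' ->
  [/\ f = 1, 2 <= hx & 2 <= hy] \/ [/\ 2 <= f, 0 < hx & 0 < hy] ->
  (f = 1 -> hx = 2 -> hy <= 2) -> (f = 1 -> hy = 2 -> hx <= 2) ->
  (f = 2 -> hx = 1 -> hy <= 1) -> (f = 2 -> hy = 1 -> hx <= 1) ->
  0 < f' -> 0 < hz ->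
  [/\ f = 1, f' = 1, hx = 2, hy = 2 & hz = 2] \/
  [/\ f = 2, f' = 2, hx = 1, hy = 1 & hz = 1].
Proof.
move=> u0 u0' w0 w0' D0 e1 e2 e3 e4 e5 e6 e7 c c1 c2 c3 c4 f0 h0.
have hx0 : 0 < hx by lia.
have hy0 : 0 < hy by lia.
have fp : 0 < f by lia.
have := one_or_two_or_more u' h0; have := one_or_two_or_more u' hy0.
have := one_or_two_or_more u hx0; have := one_or_two_or_more D f0.
have := one_or_two_or_more D fp.
move: e1 e2 e3 e4 e5 e6 e7; move: (f * D) (f' * D) (hx * u) (hy * u') (hz * u') => F F' X Y Z.
move=> e1 e2 e3 e4 e5 e6 e7.
case=> [[? ?]|[[? ?]|[? ?]]]; case=> [[? ?]|[[? ?]|[? ?]]]; try (exfalso; lia);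
case=> [[? ?]|[[? ?]|[? ?]]]; try (exfalso; lia);
case=> [[? ?]|[[? ?]|[? ?]]]; try (exfalso; lia);
case=> [[? ?]|[[? ?]|[? ?]]]; try (exfalso; lia); subst.
all: by case: c => [[? ? ?]|[? ? ?]]; first [by [] | by left | by right | exfalso; lia].
Qed.

(** A second fixing node, with coordinate [M], hangs on the first one. The equations of all four
    nodes make the new edge simple at every object. *)
Lemma entries_12ee (f h gx gy gz t u u' w w' D M : nat) :
  0 < u -> 0 < u' -> 0 < w -> 0 < w' -> 0 < D -> 0 < M ->
  u + u' = 2 + (w + f * D) -> u' + u' = 2 + (w' + f * D) ->
  w + w' = 2 + u' -> w + w = 2 + u ->
  D + D = 2 + (h * u + gx * M) -> D + D = 2 + (h * u' + gy * M) ->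
  D + D = 2 + (h * u' + gz * M) -> M + M = 2 + t * D ->
  f = 1 /\ h = 2 \/ f = 2 /\ h = 1 ->
  0 < gx -> 0 < gy -> 0 < gz -> 0 < t ->
  [/\ gx = 1, gy = 1, gz = 1 & t = 1].
Proof.
move=> u0 u0' w0 w0' D0 M0 e1 e2 e3 e4 e5 e6 e7 e8 fh gx0 gy0 gz0 t0.
have := one_or_more M gx0; have := one_or_more M gy0.
have := one_or_more M gz0; have := one_or_more D t0.
move: e5 e6 e7 e8; move: (gx * M) (gy * M) (gz * M) (t * D) => X Y Z T e5 e6 e7 e8.
by case: fh => [[? ?]|[? ?]]; case=> [[? ?]|[? ?]]; case=> [[? ?]|[? ?]];
  case=> [[? ?]|[? ?]]; case=> [[? ?]|[? ?]]; subst; try (exfalso; lia).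
Qed.

Local Open Scope ring_scope.

(** * Root systems of Cartan schemes *)

(** Roots are given by a [Prop]-valued predicate; classical logic provides a duplicate-free list
    over which they can be summed and counted. *)
Lemma enum_Prop (T : eqType) (P : T -> Prop) (s : seq T) :
  (forall v, P v -> v \in s) -> exists s', uniq s' /\ forall v, v \in s' <-> P v.
Proof.
move=> Ps; suff [s' [us' s'P]] : exists s', uniq s' /\ forall v, v \in s' <-> v \in s /\ P v.
  exists s'; split=> // v; rewrite s'P; split=> [[]//|Pv]; split=> //; exact: Ps.
elim: s {Ps} => [|a s [s' [us' s'P]]].
  by exists [::]; split=> // v; split=> // -[].
case: (classic (P a /\ a \notin s')) => [[Pa nas']|nP].
  exists (a :: s'); split=> [|v]; first by rewrite /= nas'.
  rewrite !inE; split=> [/orP[/eqP->|/s'P[vs Pv]]|[/orP[/eqP->|vs] Pv]].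
  - by rewrite eqxx.
  - by rewrite vs orbT.
  - by rewrite eqxx.
  - by apply/orP; right; apply/s'P.
exists s'; split=> // v; rewrite s'P inE; split=> [[vs Pv]|[/orP[/eqP va|vs] Pv]] //.
  by rewrite vs orbT.
rewrite va in Pv *; case: (boolP (a \in s')) => [/s'P //|nas'].
by case: nP.
Qed.

Lemma oppvE n (v : 'rV[int]_n) k : (- v) 0 k = - v 0 k.
Proof. by rewrite mxE. Qed.

Lemma addvE n (u v : 'rV[int]_n) k : (u + v) 0 k = u 0 k + v 0 k.
Proof. by rewrite mxE. Qed.

Lemma scalevE n c (v : 'rV[int]_n) k : (c *: v) 0 k = c * v 0 k.
Proof. by rewrite mxE. Qed.

Section RootSystem.

Variables (n : nat) (A : finType) (rho : 'I_n -> A -> A) (C : A -> 'M[int]_n).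
Variable R : A -> 'rV[int]_n -> Prop.
Hypothesis schemeC : cartan_scheme rho C.
Hypothesis rsR : root_system rho C R.
Hypothesis finR : finite_rs R.

Local Notation alpha := (@alpha n).
Local Notation sigma := (sigma C).

Definition cart (a : A) (i j : 'I_n) : nat := absz (C a i j).

Lemma rhoK i a : rho i (rho i a) = a.
Proof. by case: schemeC => _ [+ _]; apply. Qed.

Lemma C_diag a i : C a i i = 2.
Proof. by case: schemeC => /(_ a) [+ _] _; apply. Qed.

Lemma C_cart a i j : i != j -> C a i j = - (cart a i j)%:Z.
Proof.
by move=> ij; case: schemeC => /(_ a) [_ [/(_ _ _ ij) + _]] _; rewrite /cart; lia.
Qed.

Lemma C_rho a i j : C (rho i a) i j = C a i j.
Proof. by case: schemeC => _ [_ /(_ a i j)]. Qed.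

Lemma cart_rho a i j : cart (rho i a) i j = cart a i j.
Proof. by rewrite /cart C_rho. Qed.

Lemma cart_eq0 a i j : (cart a i j == 0)%N = (cart a j i == 0)%N.
Proof.
case: schemeC => /(_ a) [_ [_ H]] _; rewrite /cart !absz_eq0.
by apply/eqP/eqP; apply: H.
Qed.

Lemma alphaE (i k : 'I_n) : alpha i 0 k = (k == i)%:R.
Proof. by rewrite mxE eqxx. Qed.

Lemma sigma_ne i a v k : k != i -> sigma i a v 0 k = v 0 k.
Proof. by move=> ki; rewrite !mxE eqxx (negPf ki) mulr0 subr0. Qed.

Lemma sigma_eq i a v :
  sigma i a v 0 i = - v 0 i + \sum_(j | j != i) (cart a i j)%:Z * v 0 j.
Proof.
rewrite !mxE !eqxx mulr1 (bigD1 i) //= C_diag.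
rewrite (eq_bigr (fun j => - ((cart a i j)%:Z * v 0 j))) => [|j ji].
  by rewrite sumrN; ring.
by rewrite C_cart 1?eq_sym // mulNr.
Qed.

Lemma sigmaD i a u v : sigma i a (u + v) = sigma i a u + sigma i a v.
Proof.
rewrite /Defs.sigma addrACA -opprD -scalerDl -big_split /=.
by under eq_bigr do rewrite mxE mulrDr.
Qed.

Lemma sigmaZ i a c v : sigma i a (c *: v) = c *: sigma i a v.
Proof.
rewrite /Defs.sigma scalerBr scalerA mulr_sumr.
by under eq_bigr do rewrite mxE mulrCA.
Qed.

Lemma sigmaN i a v : sigma i a (- v) = - sigma i a v.
Proof. by rewrite -!scaleN1r sigmaZ. Qed.

Lemma sigma0 i a : sigma i a 0 = 0.
Proof. by have := sigmaZ i a 0 0; rewrite !scale0r. Qed.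

Lemma sigma_alpha i a : sigma i a (alpha i) = - alpha i.
Proof.
rewrite /Defs.sigma (bigD1 i) //= alphaE eqxx big1 => [|j ji].
  by rewrite C_diag addr0 mulr1 scaler_nat mulr2n opprD addNKr.
by rewrite alphaE (negPf ji) mulr0.
Qed.

Lemma sigma_alpha_ne i k a : i != k ->
  sigma i a (alpha k) = alpha k + (cart a i k)%:Z *: alpha i.
Proof.
move=> ik; rewrite /Defs.sigma (bigD1 k) //= alphaE eqxx big1 => [|j jk].
  by rewrite addr0 mulr1 C_cart // scaleNr opprK.
by rewrite alphaE (negPf jk) mulr0.
Qed.

Lemma sigma_rho i a v : sigma i (rho i a) v = sigma i a v.
Proof. by rewrite /Defs.sigma; under eq_bigr do rewrite C_rho. Qed.

Lemma sigmaK i a v : sigma i (rho i a) (sigma i a v) = v.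
Proof.
rewrite sigma_rho {2}/Defs.sigma sigmaD sigmaN sigmaZ sigma_alpha.
by rewrite scalerN opprK /Defs.sigma subrK.
Qed.

Lemma sigmaK' i a v : sigma i a (sigma i (rho i a) v) = v.
Proof. by rewrite -{1}[a](rhoK i) sigmaK. Qed.

Lemma R_sigma i a v : R a v -> R (rho i a) (sigma i a v).
Proof. by case: rsR => _ [_ [H _]] Rv; apply/H; exists v. Qed.

Lemma R_sign a v : R a v -> nonneg v \/ nonneg (- v).
Proof. by case: rsR => H _ /H [[]|[]]; [left|right]. Qed.

Lemma R_opp a v : R a v -> R a (- v).
Proof.
case: rsR => H _ Rv; case: (R_sign Rv) => [pv|nv].
  by apply/H; right; rewrite opprK.
by case/H: Rv => [[Rv pv]|[]] //; apply/H; right; rewrite opprK.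
Qed.

Lemma R_alpha a i : R a (alpha i).
Proof. by case: rsR => _ [H _]; case: (H a i (alpha i)) => _ [|//]; left. Qed.

Lemma R_multiple a i k : R a (k *: alpha i) -> k = 1 \/ k = -1.
Proof.
case: rsR => _ [H _] Rv; case: (H a i (k *: alpha i)) => + _.
case; first by split=> //; exists k.
  by move/matrixP/(_ 0 i); rewrite !mxE !eqxx mulr1; left.
by move/matrixP/(_ 0 i); rewrite !mxE !eqxx mulr1; right.
Qed.

Lemma R_pos a v k : R a v -> 0 < v 0 k -> nonneg v.
Proof. by move=> /R_sign [//|/(_ k)]; rewrite oppvE => h1 h2; exfalso; lia. Qed.

(** By (R2) a positive root other than [alpha i] has a positive coordinate outside [i]. The
    reflection keeps this coordinate, which decides the sign of the image. *)
Lemma nonneg_sigma i a v :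
  R a v -> nonneg v -> v != alpha i -> nonneg (sigma i a v).
Proof.
move=> Rv pv vi.
case: (pickP (fun k => (k != i) && (0 < v 0 k))) => [k /andP[ki vk]|nk].
  by apply: (@R_pos (rho i a) _ k); [exact: R_sigma | rewrite sigma_ne].
have ev : v = v 0 i *: alpha i.
  apply/rowP => k; rewrite scalevE alphaE; have := nk k; have := pv k.
  by case: (eqVneq k i) => [->|ki] /=; [rewrite mulr1 | rewrite mulr0; lia].
move: Rv; rewrite ev => /R_multiple [vi1|vi1].
  by move: vi; rewrite ev vi1 scale1r eqxx.
by have := pv i; rewrite vi1.
Qed.

Lemma alpha_ge0 i : nonneg (alpha i).
Proof. by move=> k; rewrite alphaE; lia. Qed.

(** * Rank two: roots in a coordinate plane and (R4) *)

Definition comb (i j : 'I_n) (k l : int) : 'rV[int]_n := k *: alpha i + l *: alpha j.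

Lemma combC i j k l : comb i j k l = comb j i l k.
Proof. exact: addrC. Qed.

Lemma comb_l i j k l : i != j -> comb i j k l 0 i = k.
Proof. by move=> ij; rewrite !mxE !eqxx (negPf ij) mulr1 mulr0 addr0. Qed.

Lemma comb_r i j k l : i != j -> comb i j k l 0 j = l.
Proof. by rewrite eq_sym combC; exact: comb_l. Qed.

Lemma comb_sigma i j a k l : i != j ->
  sigma i a (comb i j k l) = comb i j ((cart a i j)%:Z * l - k) l.
Proof.
move=> ij; rewrite /comb sigmaD !sigmaZ sigma_alpha sigma_alpha_ne //.
by rewrite scalerDr scalerN scalerA scalerBl addrC [_ + (l * _) *: _]addrC mulrC [RHS]addrAC.
Qed.

Lemma comb_step_l i j a k l : i != j ->
  R a (comb i j k l) -> R (rho i a) (comb i j ((cart a i j)%:Z * l - k) l).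
Proof. by move=> ij /R_sigma-/(_ i); rewrite comb_sigma. Qed.

Lemma comb_step_r i j a k l : i != j ->
  R a (comb i j k l) -> R (rho j a) (comb i j k ((cart a j i)%:Z * k - l)).
Proof. by rewrite eq_sym => ji; rewrite combC => /(comb_step_l ji); rewrite combC. Qed.

Lemma comb_sign i j a k l : i != j -> R a (comb i j k l) ->
  (0 <= k) && (0 <= l) || (k <= 0) && (l <= 0).
Proof.
move=> ij /R_sign [] h; have := h i; have := h j;
  rewrite ?oppvE ?comb_l ?comb_r //; lia.
Qed.

Lemma comb_l0 i j a k : R a (comb i j k 0) -> k = 1 \/ k = -1.
Proof. by rewrite /comb scale0r addr0 => /R_multiple. Qed.

Lemma comb_r0 i j a l : R a (comb i j 0 l) -> l = 1 \/ l = -1.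
Proof. by rewrite combC => /comb_l0. Qed.

Lemma comb_back_l i j a k l : i != j ->
  R (rho i a) (comb i j k l) -> R a (comb i j ((cart a i j)%:Z * l - k) l).
Proof. by move=> ij /(comb_step_l ij); rewrite rhoK cart_rho. Qed.

Lemma comb_back_r i j a k l : i != j ->
  R (rho j a) (comb i j k l) -> R a (comb i j k ((cart a j i)%:Z * k - l)).
Proof. by move=> ij /(comb_step_r ij); rewrite rhoK cart_rho. Qed.

(** (R4) in coordinates: [s] lists the pairs of coefficients of the positive roots in the plane, so
    its size is the exponent. *)
Lemma rank2_iter a i j (s : seq (nat * nat)) : i != j -> uniq s ->
  {in s, forall p, R a (comb i j p.1%:Z p.2%:Z)} ->
  (forall k l : nat, R a (comb i j k%:Z l%:Z) -> (k, l) \in s) ->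
  iter (size s) (fun b => rho i (rho j b)) a = a.
Proof.
move=> ij us sR Rs; case: rsR => _ [_ [_ R4]].
pose f (p : nat * nat) := comb i j p.1%:Z p.2%:Z.
have fI : injective f.
  move=> [k l] [k' l'] /rowP e; have := e i; have := e j.
  by rewrite !comb_l ?comb_r //= => -[->] [->].
rewrite -(size_map f); apply: R4 => //; first by rewrite map_inj_uniq.
move=> v; split=> [/mapP [p /sR Rp ->]|[Rv [k [l ev]]]].
  split=> //; exists p.1, p.2.
  by rewrite /f /comb -!scaler_nat !natz.
have ev' : v = f (k, l) by rewrite ev /f /comb -!scaler_nat !natz.
by rewrite ev' map_f //; apply: Rs; move: Rv; rewrite ev'.
Qed.

Lemma comb10 i j a : R a (comb i j 1 0).
Proof. by rewrite /comb scale1r scale0r addr0; apply: R_alpha. Qed.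

Lemma comb01 i j a : R a (comb i j 0 1).
Proof. by rewrite combC; apply: comb10. Qed.

(** Here [sigma i] sends [(k, l)] to [(-k, l)], so the sign condition leaves only the two simple
    roots and m = 2. *)
Lemma cart0_iter a i j : i != j -> cart a i j = 0%N ->
  iter 2 (fun b => rho i (rho j b)) a = a.
Proof.
move=> ij c0; apply: (@rank2_iter a i j [:: (1, 0); (0, 1)]%N) => //.
  by move=> p; rewrite !inE => /orP[] /eqP -> /=; [apply: comb10 | apply: comb01].
move=> k l Rv; rewrite !inE !xpair_eqE.
have := comb_sign ij (comb_step_l ij Rv); rewrite c0 mul0r sub0r.
case: l Rv => [|l] Rv; first by have := comb_l0 Rv; lia.
case: k Rv => [|k] Rv; first by have := comb_r0 Rv; lia.
lia.
Qed.

(** With [c3] the entry in question, [alpha j] at [rho i (rho j a)] is carried to the root with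
    coefficients [(-1, c3 - 1)] at [rho i a]; its sign gives [c3 <= 1]. *)
Lemma cart11_adj a i j : i != j -> cart a i j = 1%N -> cart a j i = 1%N ->
  cart (rho j a) i j = 1%N.
Proof.
move=> ij c1 c2; set c3 := cart (rho j a) i j.
have c3_gt0 : c3 != 0%N by rewrite cart_eq0 cart_rho c2.
have := comb01 i j (rho i (rho j a)).
move=> /(comb_back_l ij) /(comb_back_r ij) /(comb_step_l ij) /(comb_sign ij).
rewrite -/c3 c1 c2; lia.
Qed.

(** The images [(l - k, l)] and [(l - k, -k)] of a root [(k, l)] with positive coefficients have
    coherent signs only if [k = l]; then (R2) leaves [(1, 1)], so m = 3. *)
Lemma cart11_iter a i j : i != j -> cart a i j = 1%N -> cart a j i = 1%N ->
  iter 3 (fun b => rho i (rho j b)) a = a.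
Proof.
move=> ij c1 cji; have c2 : cart (rho i a) j i = 1%N by apply: cart11_adj; rewrite // eq_sym.
apply: (@rank2_iter a i j [:: (1, 0); (0, 1); (1, 1)]%N) => //.
  move=> p; rewrite !inE => /or3P[] /eqP -> /=; [exact: comb10 | exact: comb01 |].
  by have := comb_back_l ij (comb01 i j (rho i a)); rewrite c1.
move=> k l Rv; rewrite !inE !xpair_eqE.
have R1 := comb_step_l ij Rv; have R2 := comb_step_r ij R1.
have := comb_sign ij R1; have := comb_sign ij R2; rewrite c1 c2.
case: l Rv R1 R2 => [|l] Rv R1 R2; first by have := comb_l0 Rv; lia.
case: k Rv R1 R2 => [|k] Rv R1 R2; first by have := comb_r0 Rv; lia.
case: (eqVneq k l) R1 => [->|kl] R1; last lia.
have /comb_r0 : R (rho i a) (comb i j 0 l.+1) by move: R1; rewrite c1 mul1r subrr.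
lia.
Qed.

(** Three reflections give [(l - k, l)], [(l - k, l - 2k)] and [(-k, l - 2k)]. Their signs force
    [l = k] or [l = 2k], hence m = 4. *)
Lemma cart121_iter a i j : i != j -> cart a i j = 1%N ->
  cart (rho i a) j i = 2%N -> cart (rho j (rho i a)) i j = 1%N ->
  iter 4 (fun b => rho i (rho j b)) a = a.
Proof.
move=> ij c1 c2 c3.
apply: (@rank2_iter a i j [:: (1, 0); (0, 1); (1, 1); (1, 2)]%N) => //.
  move=> p; rewrite !inE => /or4P[] /eqP -> /=; [exact: comb10 | exact: comb01 | |].
    by have := comb_back_l ij (comb01 i j (rho i a)); rewrite c1.
  have := comb_back_l ij (comb_back_r ij (comb10 i j (rho j (rho i a)))).
  by rewrite c1 c2.
move=> k l Rv; rewrite !inE !xpair_eqE.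
have R1 := comb_step_l ij Rv; have R2 := comb_step_r ij R1; have R3 := comb_step_l ij R2.
have := comb_sign ij R1; have := comb_sign ij R2; have := comb_sign ij R3.
rewrite c1 c2 c3.
case: l Rv R1 R2 R3 => [|l] Rv R1 R2 R3; first by have := comb_l0 Rv; lia.
case: k Rv R1 R2 R3 => [|k] Rv R1 R2 R3; first by have := comb_r0 Rv; lia.
case: (eqVneq k l) R1 => [->|kl] R1.
  have /comb_r0 : R (rho i a) (comb i j 0 l.+1) by move: R1; rewrite c1 mul1r subrr.
  lia.
case: (eqVneq l.+1 (2 * k.+1)%N) R2 => [lk|lk] R2; last lia.
have /comb_l0 : R (rho j (rho i a)) (comb i j k.+1 0).
  by move: R2; rewrite c1 c2 lk; congr (R _ (comb _ _ _ _)); lia.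
lia.
Qed.

(** If [e] is the entry to be bounded, pulling a simple root back through the four reflections
    yields the root [(-1, e - 2)] at [a]. In [cart212_le] it is [(-1, e - 1)]. *)
Lemma cart121_le a i j : i != j -> cart a i j = 1%N ->
  cart (rho i a) j i = 2%N -> cart (rho j (rho i a)) i j = 1%N ->
  (cart (rho i (rho j (rho i a))) j i <= 2)%N.
Proof.
move=> ij c1 c2 c3; have := comb10 i j (rho j (rho i (rho j (rho i a)))).
move=> /(comb_back_r ij) /(comb_back_l ij) /(comb_back_r ij) /(comb_back_l ij).
move=> /(comb_sign ij); rewrite c1 c2 c3; lia.
Qed.

Lemma cart212_le a i j : i != j -> cart a i j = 2%N ->
  cart (rho i a) j i = 1%N -> cart (rho j (rho i a)) i j = 2%N ->
  (cart (rho i (rho j (rho i a))) j i <= 1)%N.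
Proof.
move=> ij c1 c2 c3; have := comb10 i j (rho j (rho i (rho j (rho i a)))).
move=> /(comb_back_r ij) /(comb_back_l ij) /(comb_back_r ij) /(comb_back_l ij).
move=> /(comb_sign ij); rewrite c1 c2 c3; lia.
Qed.

(** * Unjoined nodes and sums of positive roots *)

Lemma cart0_comm a i j : i != j -> cart a i j = 0%N ->
  rho i (rho j a) = rho j (rho i a).
Proof. by move=> ij /(cart0_iter ij) /= {2}<-; rewrite !rhoK. Qed.

(** Apply [sigma j], [sigma i], [sigma j] in turn to [alpha k]. As [rho i] and [rho j] commute, this
    ends at [rho i a], in a positive root whose coefficient at [alpha j] is the difference of the
    two entries. *)
Lemma cart0_row_le a i j k : i != j -> cart a i j = 0%N ->
  (cart a j k <= cart (rho i a) j k)%N.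
Proof.
move=> ij c0; case: (eqVneq k j) => [->|kj]; first by rewrite /cart !C_diag.
have cji : cart a j i = 0%N by apply/eqP; rewrite -cart_eq0 c0.
case: (eqVneq k i) => [->|ki]; first by rewrite cji.
have jk : j != k by rewrite eq_sym.
have ik : i != k by rewrite eq_sym.
have ji : j != i by rewrite eq_sym.
have com := cart0_comm ij c0.
have c1 : cart (rho j a) i j = 0%N by apply/eqP; rewrite cart_eq0 cart_rho cji.
have c2 : cart (rho i a) j i = 0%N by apply/eqP; rewrite cart_eq0 cart_rho c0.
have := R_sigma j (R_sigma i (R_sigma j (R_alpha a k))).
rewrite com rhoK sigma_rho (sigma_alpha_ne a jk) (sigmaD i) (sigmaZ i).
rewrite (sigma_alpha_ne _ ik) (sigma_alpha_ne _ ij) c1 scale0r addr0.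
rewrite !(sigmaD j) !(sigmaZ j) (sigma_alpha_ne _ jk) (sigma_alpha_ne _ ji) c2.
rewrite scale0r addr0 sigma_alpha.
set v := (X in R _ X) => Rv.
have vE l : v 0 l = (l == k)%:R + (cart (rho i a) j k)%:Z * (l == j)%:R
    + (cart (rho j a) i k)%:Z * (l == i)%:R - (cart a j k)%:Z * (l == j)%:R.
  by rewrite /v !(addvE, scalevE, oppvE, alphaE) mulrN.
have vk : 0 < v 0 k by rewrite vE eqxx (negPf kj) (negPf ki); lia.
by have := R_pos Rv vk j; rewrite vE eqxx (negPf jk) (negPf ji); lia.
Qed.

Lemma cart0_row a i j k : i != j -> cart a i j = 0%N ->
  cart (rho i a) j k = cart a j k.
Proof.
move=> ij c0; apply/eqP; rewrite eqn_leq cart0_row_le // andbT.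
by rewrite -{2}[a](rhoK i) cart0_row_le // cart_rho.
Qed.

(* The sum of the positive roots with support in [J] transforms under
   [sigma i] as [2 rho] does, because [sigma i] permutes these roots except
   for [alpha i]. *)
Lemma root_sums (J : {pred 'I_n}) : exists d : A -> 'I_n -> nat,
  [/\ forall a k, k \in J -> (0 < d a k)%N,
      forall a k, k \notin J -> d a k = 0%N,
      forall a i k, i \in J -> k != i -> d (rho i a) k = d a k &
      forall a i, i \in J ->
        (d a i + d (rho i a) i = 2 + \sum_(k | k != i) cart a i k * d a k)%N].
Proof.
pose P a v := R a v /\ nonneg v /\ forall k, k \notin J -> v 0 k = 0.
have [s sP] : exists s : A -> seq 'rV[int]_n, forall a, uniq (s a) /\
    forall v, v \in s a <-> P a v.
  apply: (fin_all_exists (P := fun a t => uniq t /\ forall v, v \in t <-> P a v)) => a.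
  have [t tP] := finR a; apply: (enum_Prop (s := t)) => v [Rv _]; exact: tP.
pose w a := \sum_(v <- s a) v.
have w_ge0 a k : 0 <= w a 0 k.
  rewrite /w summxE; rewrite big_seq; apply: sumr_ge0 => v /(proj2 (sP a)) [_ [pv _]].
  exact: pv.
have wE a k : w a 0 k = (absz (w a 0 k))%:Z by have := w_ge0 a k; lia.
have s_alpha a i : i \in J -> alpha i \in s a.
  move=> iJ; apply/(proj2 (sP a)); split; first exact: R_alpha.
  split=> [|k kJ]; first exact: alpha_ge0.
  by rewrite alphaE; case: eqP kJ => [->|//]; rewrite iJ.
have s_sigma a i v : i \in J -> v \in s a -> v != alpha i ->
    (sigma i a v \in s (rho i a)) && (sigma i a v != alpha i).
  move=> iJ /(proj2 (sP a)) [Rv [pv vJ]] vi; apply/andP; split.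
    apply/(proj2 (sP (rho i a))); split; first exact: R_sigma.
    split=> [|k kJ]; first exact: nonneg_sigma.
    by rewrite sigma_ne ?vJ //; apply: contraNneq kJ => ->.
  apply/eqP => /(congr1 (sigma i a)); rewrite -{1}sigma_rho sigmaK sigma_alpha => ev.
  by have := pv i; rewrite ev oppvE alphaE eqxx.
have w_rem a i : i \in J -> w a = alpha i + \sum_(v <- rem (alpha i) (s a)) v.
  by move=> iJ; rewrite /w (big_rem _ (s_alpha a i iJ)).
(* Once [alpha i] is split off, [sigma i] maps the remaining roots at [a] bijectively onto those at
   [rho i a]; the sign change of [alpha i] accounts for the summand [alpha i *+ 2]. *)
have w_sigma a i : i \in J -> w (rho i a) = sigma i a (w a) + alpha i *+ 2.
  move=> iJ; rewrite (w_rem _ _ iJ) (w_rem a _ iJ) sigmaD sigma_alpha.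
  have -> : sigma i a (\sum_(v <- rem (alpha i) (s a)) v) =
      \sum_(v <- map (sigma i a) (rem (alpha i) (s a))) v.
    by rewrite big_map; apply: (big_morph _ (sigmaD i a) (sigma0 i a)).
  rewrite mulr2n addrACA addNr add0r [RHS]addrC; congr (_ + _).
  apply: perm_big; apply: uniq_perm.
  - exact/rem_uniq/(proj1 (sP _)).
  - rewrite map_inj_uniq; first exact/rem_uniq/(proj1 (sP _)).
    by apply: can_inj (sigmaK i a).
  move=> v; rewrite mem_rem_uniq ?(proj1 (sP _)) // inE /=.
  apply/andP/mapP => [[vi vs]|[u us ->]]; last first.
    move: us; rewrite mem_rem_uniq ?(proj1 (sP _)) // inE /= => /andP[ui us].
    by have /andP[] := s_sigma a i u iJ us ui.
  exists (sigma i (rho i a) v); last by rewrite sigmaK'.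
  rewrite mem_rem_uniq ?(proj1 (sP _)) // inE /=.
  by have := s_sigma (rho i a) i v iJ vs vi; rewrite rhoK andbC.
exists (fun a k => absz (w a 0 k)); split.
- move=> a k kJ; suff : 0 < w a 0 k by lia.
  rewrite (w_rem a k kJ) addvE alphaE eqxx; apply: ltr_pwDl => //.
  rewrite summxE big_seq; apply: sumr_ge0 => v /mem_rem /(proj2 (sP a)) [_ [pv _]].
  exact: pv.
- move=> a k kJ; apply/eqP; rewrite absz_eq0; apply/eqP; rewrite /w summxE big_seq.
  by apply: big1 => v /(proj2 (sP a)) [_ [_ ->]].
- move=> a i k iJ ki; rewrite w_sigma // addvE sigma_ne // mulr2n addvE alphaE.
  by rewrite (negPf ki) !addr0.
move=> a i iJ; apply/eqP; rewrite -eqz_nat !PoszD -!wE w_sigma // addvE sigma_eq.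
have -> : Posz (\sum_(k | k != i) cart a i k * absz (w a 0%R k))%N =
    \sum_(k | k != i) (cart a i k)%:Z * w a 0 k.
  rewrite (big_morph Posz PoszD (erefl _)); apply: eq_bigr => k _.
  by rewrite PoszM -wE.
rewrite mulr2n addvE alphaE eqxx.
by apply/eqP => /=; ring.
Qed.

Lemma root_sums_seq (J : seq 'I_n) : uniq J -> exists d : A -> 'I_n -> nat,
  [/\ forall a k, k \in J -> (0 < d a k)%N,
      forall a i k, i \in J -> k != i -> d (rho i a) k = d a k &
      forall a i, i \in J ->
        (d a i + d (rho i a) i = 2 + \sum_(k <- J | k != i) cart a i k * d a k)%N].
Proof.
move=> uJ; have [d [d_gt0 d_out d_ne d_eq]] := root_sums (mem J).
exists d; split=> // a i iJ; rewrite d_eq //; congr addn.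
rewrite -[RHS]big_filter [RHS]big_uniq ?filter_uniq //= [RHS]big_mkcond [LHS]big_mkcond.
apply: eq_bigr => k _; rewrite mem_filter; case: (k != i) => //=.
by case: ifP => // /negbT kJ; rewrite d_out ?muln0.
Qed.

(* Averaging the root sums over all objects shows that the entrywise minimum
   of the Cartan matrices is of finite type. *)
Lemma min_cartan_finite (a0 : A) : exists D : 'I_n -> nat,
  forall i (s : seq (nat * 'I_n)), uniq (i :: map snd s) ->
    (forall p, p \in s -> forall a, p.1 <= cart a i p.2)%N ->
    (\sum_(p <- s) p.1 * D p.2 < 2 * D i)%N.
Proof.
have [d [_ _ _ d_eq]] := root_sums predT.
exists (fun k => \sum_a d a k)%N => i s /= /andP[is_ us] sle.
(* The involution [rho i] permutes the objects, so the terms at [a] and at [rho i a] have the same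
   total. *)
have -> : (2 * \sum_a d a i = \sum_a (d a i + d (rho i a) i))%N.
  rewrite mul2n -addnn big_split /=; congr addn.
  by rewrite (reindex_inj (can_inj (rhoK i))).
rewrite (eq_bigr _ (fun a _ => d_eq a i isT)) big_split /= sum_nat_const.
(* The constant 2 contributed by each object makes the inequality strict; [a0] shows that there is
   an object. *)
apply: (@leq_ltn_trans (\sum_a \sum_(k | k != i) cart a i k * d a k)); last first.
  rewrite -[X in (X < _)%N]add0n ltn_add2r muln_gt0 andbT.
  by apply/card_gt0P; exists a0.
under eq_bigr do rewrite big_distrr /=.
rewrite exchange_big /=; apply: leq_sum => a _.
apply: (@leq_trans (\sum_(p <- s) cart a i p.2 * d a p.2)).
  rewrite big_seq [X in (_ <= X)%N]big_seq; apply: leq_sum => p ps.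
  by rewrite leq_mul2r sle ?orbT.
rewrite -(big_map snd xpredT (fun k => cart a i k * d a k)%N) big_uniq //=.
rewrite big_mkcond [X in (_ <= X)%N]big_mkcond; apply: leq_sum => k _.
by case: ifP => // ks; case: eqP => // ki; rewrite -ki ks in is_.
Qed.

(** * Walks in the Weyl groupoid and connectedness of the diagrams *)

(** A product of reflections from [a] to an object, carried together with its inverse. *)
Inductive gwalk (a : A) : A -> ('rV[int]_n -> 'rV[int]_n) ->
    ('rV[int]_n -> 'rV[int]_n) -> Prop :=
| gwalk_nil : gwalk a a id id
| gwalk_step b f g i : gwalk a b f g ->
    gwalk a (rho i b) (sigma i b \o f) (g \o sigma i (rho i b)).

Lemma gwalkP a b f g : gwalk a b f g ->
  [/\ forall v, R a v -> R b (f v), forall v, R b v -> R a (g v),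
      cancel f g /\ cancel g f, forall c u v, f (c *: u + v) = c *: f u + f v &
      forall c u v, g (c *: u + v) = c *: g u + g v].
Proof.
elim=> {b f g} [|b f g i _ [fR gR [fK gK] fL gL]]; first by [].
split=> [v Rv|v Rv||c u v|c u v] /=.
- exact/R_sigma/fR.
- by apply: gR; have := R_sigma i Rv; rewrite rhoK.
- by split=> v /=; rewrite ?sigmaK ?fK // gK sigmaK'.
- by rewrite fL sigmaD sigmaZ.
- by rewrite sigmaD sigmaZ gL.
Qed.

Lemma nonneg_anti (v : 'rV[int]_n) : nonneg v -> nonneg (- v) -> v = 0.
Proof.
move=> pv nv; apply/rowP => k; have := pv k; have := nv k.
by rewrite oppvE [RHS]mxE; move: (v 0 k) => x; lia.
Qed.

Lemma R_not0 a (i : 'I_n) : ~ R a 0.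
Proof. by rewrite -(scale0r (alpha i)) => /R_multiple []. Qed.

Lemma nonnegP (v : 'rV[int]_n) : reflect (nonneg v) [forall k, 0 <= v 0 k].
Proof. exact: forallP. Qed.

(* A walk inverting as many positive roots as possible inverts all of them,
   as otherwise some [alpha j] is the image of a positive root and the walk
   can be prolonged by [sigma j]. *)
Lemma longest_gwalk a : exists b f g, gwalk a b f g /\
  forall v, R a v -> nonneg v -> nonneg (- f v).
Proof.
have [t tP] := finR a.
have [s [us sP]] : exists s, uniq s /\ forall v, v \in s <-> R a v /\ nonneg v.
  by apply: (enum_Prop (s := t)) => v [/tP].
pose neg (f : 'rV[int]_n -> 'rV[int]_n) := [pred v | ~~ [forall k, 0 <= f v 0 k]].
(* The number [m] strictly exceeds the number of positive roots not yet inverted, so [m = 0] cannot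
   occur. *)
suff H m b f g : gwalk a b f g -> (size s < count (neg f) s + m)%N ->
    exists b f g, gwalk a b f g /\ forall v, R a v -> nonneg v -> nonneg (- f v).
  by apply: (H (size s).+1 _ _ _ (gwalk_nil a)); rewrite addnS ltnS leq_addl.
elim: m b f g => [|m IH] b f g w; first by rewrite addn0 ltnNge count_size.
have [fR gR [fK gK] fL gL] := gwalkP w.
have f0 : f 0 = 0 by have := fL (-1) 0 0; rewrite scaler0 add0r scaleN1r addNr.
have g0 : g 0 = 0 by have := gL (-1) 0 0; rewrite scaler0 add0r scaleN1r addNr.
have fN v : f (- v) = - f v by have := fL (-1) v 0; rewrite !scaleN1r f0 !addr0.
case: (classic (exists j, nonneg (g (alpha j)))) => [[j gj] ltm|nj _]; last first.
  (* Every [g (alpha j)] is negative here, so a positive [f v] would make [v = g (f v)] a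
     nonnegative combination of negative roots. *)
  exists b, f, g; split=> // v Rv pv; case: (R_sign (fR v Rv)) => // pf k.
  suff v0 : v = 0 by case: (@R_not0 a k); rewrite -v0.
  apply: nonneg_anti => // l; rewrite -[v]fK [f v]row_sum_delta.
  suff -> : g (\sum_j f v 0 j *: delta_mx 0 j) = \sum_j f v 0 j *: g (alpha j).
    rewrite oppvE summxE -sumrN; apply: sumr_ge0 => j _.
    rewrite scalevE -mulrN mulr_ge0 //.
    case: (R_sign (gR _ (R_alpha b j))) => [gj|/(_ l)]; first by case: nj; exists j.
    by rewrite oppvE.
  elim/big_rec2: _ => [|j u u' _ <-]; first exact: g0.
  by rewrite gL.
apply: (IH _ _ _ (gwalk_step j w)); apply: leq_trans ltm _.
rewrite addnS -addSn leq_add2r -!size_filter.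
(* The prolonged walk inverts [g (alpha j)] in addition to all roots inverted before. *)
have : uniq (g (alpha j) :: filter (neg f) s).
  rewrite /= filter_uniq // andbT mem_filter /= gK negb_and negbK.
  by apply/orP; left; apply/nonnegP/alpha_ge0.
move/uniq_leq_size; apply => u; rewrite inE mem_filter => /orP[/eqP ->|/andP[nu us_]].
  rewrite mem_filter /= gK sigma_alpha; apply/andP; split.
    by apply/nonnegP => /(_ j); rewrite oppvE alphaE eqxx.
  by apply/sP; split=> //; apply/gR/R_alpha.
rewrite mem_filter us_ andbT /=; apply/nonnegP => p1.
have [Ru pu] := proj1 (sP u) us_.
have Rfu := fR _ Ru.
have nfu : nonneg (- f u) by case: (R_sign Rfu) => // /nonnegP pf; move: nu; rewrite /= pf.
have uj : - f u != alpha j.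
  apply/eqP => e; apply: (@R_not0 a j); suff <- : u = 0 by [].
  by apply: nonneg_anti => //; rewrite -[- u]fK fN e.
have := nonneg_sigma (R_opp Rfu) nfu uj; rewrite sigmaN => p2.
by apply: (@R_not0 (rho j b) j); rewrite -(nonneg_anti p1 p2); apply: R_sigma.
Qed.

Lemma supported_sigma (S : {set 'I_n}) a i v :
  (forall k l, k \notin S -> l \in S -> cart a k l = 0%N) ->
  supported_in S v -> supported_in S (sigma i a v).
Proof.
move=> c0 vS k kS; case: (eqVneq k i) => [ki|ki]; last by rewrite sigma_ne // vS.
rewrite -ki sigma_eq vS // big1 ?addr0 // => l lk.
case: (boolP (l \in S)) => lS; first by rewrite c0 // mul0r.
by rewrite vS // mulr0.
Qed.

(** Reflections preserve the property of being supported in neither part, and no simple root has it.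
    A positive root with it therefore stays positive along every walk, contrary to the walk that
    inverts all positive roots. *)
Lemma decomposable_roots (S : {set 'I_n}) :
  (forall a k l, k \in S -> l \notin S -> cart a k l = 0%N) ->
  forall a v, R a v -> supported_in S v \/ supported_in (~: S) v.
Proof.
move=> c0; have c0' a k l : k \notin S -> l \in S -> cart a k l = 0%N.
  by move=> kS lS; apply/eqP; rewrite cart_eq0 c0.
have c0'' a k l : k \notin ~: S -> l \in ~: S -> cart a k l = 0%N.
  by rewrite !inE negbK; apply: c0.
pose bad v := ~ (supported_in S v \/ supported_in (~: S) v).
have bad_sigma a i v : bad v -> bad (sigma i a v).
  move=> bv sv; apply: bv; rewrite -(sigmaK i a v).
  by case: sv => sv; [left | right]; apply: supported_sigma sv => k l; [apply: c0' | apply: c0''].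
have bad_alpha i : ~ bad (alpha i).
  case; case: (boolP (i \in S)) => iS; [left|right] => k kS; rewrite alphaE;
    by case: eqP kS => // ->; rewrite ?inE iS.
have no_bad a v : R a v -> nonneg v -> ~ bad v.
  move=> Rv pv bv; have [b [f [g [w /(_ v Rv pv) nfv]]]] := longest_gwalk a.
  have [pf bf] : nonneg (f v) /\ bad (f v).
    elim: w {nfv} => // {}b {}f {}g i w [pf bf]; split; last exact: bad_sigma.
    apply: nonneg_sigma => //; first by case: (gwalkP w) => fR *; apply: fR.
    by apply/eqP => e; apply: (@bad_alpha i); rewrite -e.
  by apply: bf; left => k _; rewrite (nonneg_anti pf nfv) mxE.
move=> a v Rv; apply: NNPP => bv; case: (R_sign Rv) => pv; first exact: (no_bad a v Rv pv bv).
apply: (no_bad a (- v) (R_opp Rv) pv) => sv; apply: bv.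
by case: sv => sv; [left | right] => k /sv; rewrite oppvE => /eqP; rewrite oppr_eq0 => /eqP.
Qed.

Hypothesis connC : connected_scheme rho.
Hypothesis irrR : irreducible_rs R.

(** By [cart0_row] a block of zeros at one object persists under every [rho h], hence at all objects
    by connectedness of the scheme. The roots would then decompose, against irreducibility. *)
Lemma cart_connected a (S : {set 'I_n}) : S != set0 -> ~: S != set0 ->
  exists i j, [/\ i \in S, j \notin S & cart a i j != 0%N].
Proof.
move=> S0 S1; apply: NNPP => nS; apply: irrR; exists S; split=> //; split=> //.
have za : forall i j, i \in S -> j \notin S -> cart a i j = 0%N.
  by move=> i j iS jS; apply/eqP; apply: contra_notT nS => cij; exists i, j.
apply: decomposable_roots => b; have [w <-] := connC a b.
elim: w => [//|h w] /=; move: (foldr _ _ _) => c zc i j iS jS.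
have ij : i != j by apply: contraTneq iS => ->.
case: (boolP (h \in S)) => hS.
  have hj : h != j by apply: contraTneq hS => ->.
  by apply/eqP; rewrite cart_eq0 (cart0_row i hj (zc h j hS jS)) cart_eq0 zc.
have hi : h != i by apply: contraTneq iS => <-.
have hi0 : cart c h i = 0%N by apply/eqP; rewrite cart_eq0 zc.
by rewrite (cart0_row j hi hi0) zc.
Qed.


Lemma root_sums3 i j k : i != j -> i != k -> j != k -> exists d : A -> 'I_n -> nat,
  [/\ forall a, [/\ 0 < d a i, 0 < d a j & 0 < d a k]%N,
      forall a h l, h \in [:: i; j; k] -> l != h -> d (rho h a) l = d a l,
      forall a, (d a i + d (rho i a) i = 2 + (cart a i j * d a j + cart a i k * d a k))%N,
      forall a, (d a j + d (rho j a) j = 2 + (cart a j i * d a i + cart a j k * d a k))%N &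
      forall a, (d a k + d (rho k a) k = 2 + (cart a k i * d a i + cart a k j * d a j))%N].
Proof.
move=> ij ik jk; have ji : j != i by rewrite eq_sym.
have ki : k != i by rewrite eq_sym. have kj : k != j by rewrite eq_sym.
have uJ : uniq [:: i; j; k] by rewrite /= !inE negb_or ij ik jk.
have [d [d0 dm de]] := root_sums_seq uJ.
exists d; split=> //.
- by move=> a; rewrite !d0 // !inE eqxx ?orbT.
- by move=> a; rewrite de ?inE ?eqxx // !big_cons big_nil eqxx ji ki /= addn0.
- by move=> a; rewrite de ?inE ?eqxx ?orbT // !big_cons big_nil eqxx ij kj /= addn0.
- by move=> a; rewrite de ?inE ?eqxx ?orbT // !big_cons big_nil eqxx ik jk /= addn0.
Qed.

(** * Nodes acting on three objects *)

Definition objects (x y z : A) :=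
  [/\ x != y, y != z, x != z & forall a, [\/ a = x, a = y | a = z]].

Lemma objects_rev x y z : objects x y z -> objects z y x.
Proof.
case=> xy yz xz H; split; rewrite 1?eq_sym // => a.
by case: (H a) => ->; [constructor 3 | constructor 2 | constructor 1].
Qed.

Lemma objects_swap x y z : objects x y z -> objects y x z.
Proof.
case=> xy yz xz H; split; rewrite 1?eq_sym // 1?eq_sym // => a.
by case: (H a) => ->; [constructor 2 | constructor 1 | constructor 3].
Qed.

Lemma swaps_sym (r : A -> A) u v w : swaps r u v w -> swaps r v u w.
Proof. by case=> ? [? ?]. Qed.

Lemma swaps_neq x y z i j : objects x y z ->
  swaps (rho i) x y z -> swaps (rho j) y z x -> i != j.
Proof.
move=> [xy _ _ _] [ix _] [_ [_ jx]]; apply: contraNneq xy => e.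
by rewrite -ix e jx.
Qed.

(** Otherwise m = 2, but [rho i] composed with [rho j] is a 3-cycle, whose square fixes no
    object. *)
Lemma cart_swaps_gt0 x y z i j : objects x y z ->
  swaps (rho i) x y z -> swaps (rho j) y z x ->
  forall a, (0 < cart a i j)%N /\ (0 < cart a j i)%N.
Proof.
move=> O ti tj a; have ij := swaps_neq O ti tj.
case: O ti tj => xy yz xz H [ix [iy iz]] [jy [jz jx]].
suff c0 : cart a i j != 0%N by rewrite !lt0n [X in _ /\ ~~ X]cart_eq0 c0.
apply/eqP => /(cart0_iter ij) /=.
case: (H a) => ->; rewrite !(ix, iy, iz, jx, jy, jz) => e.
- by rewrite e eqxx in xz.
- by rewrite e eqxx in xy.
- by rewrite e eqxx in yz.
Qed.

(** The first three claims propagate simple edges by [cart11_adj]. The last two exclude m = 4, since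
    the fourth power of a 3-cycle fixes no object. *)
Lemma cart_swaps_adj x y z i j : objects x y z ->
  swaps (rho i) x y z -> swaps (rho j) y z x ->
  let p := cart x i j in let q := cart y j i in
  let r := cart z i j in let s := cart x j i in
  [/\ p = 1 -> q = 1 -> r = 1 /\ s = 1, p = 1 -> s = 1 -> q = 1,
      q = 1 -> r = 1 -> p = 1, p = 1 -> s <> 2 & q = 1 -> r <> 2]%N.
Proof.
move=> O ti tj p q r s; have ij := swaps_neq O ti tj.
have ji : j != i by rewrite eq_sym.
case: O ti tj => xy yz xz H [ix [iy iz]] [jy [jz jx]].
have py : cart y i j = p by rewrite -ix cart_rho.
have qz : cart z j i = q by rewrite -jy cart_rho.
split=> [p1 q1|p1 s1|q1 r1|p1 s2|q1 r2].
- by split; [rewrite /r -jy | rewrite /s -iy]; rewrite cart11_adj ?py.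
- by rewrite /q -ix cart11_adj.
- by rewrite -py -jz cart11_adj // qz.
- have := @cart121_iter y i j ij; rewrite /= !(ix, iy, iz, jx, jy, jz) py => /(_ p1 s2 p1) e.
  by rewrite e eqxx in yz.
- have := @cart121_iter y j i ji; rewrite /= !(ix, iy, iz, jx, jy, jz) qz => /(_ q1 r2 q1) e.
  by rewrite e eqxx in xy.
Qed.

Lemma edge_fx_cart a i k : edge_fx (cart a i k) (cart a k i).
Proof.
case: (posnP (cart a i k)) => [c0|c0]; [left|right]; split=> //.
  by apply/eqP; rewrite -cart_eq0 c0.
by rewrite lt0n -cart_eq0 -lt0n.
Qed.

Definition fixes_all k := forall a, rho k a = a.

Lemma edge_mv_cart a i k : fixes_all k -> rho i a != a ->
  edge_mv (cart a i k) (cart a k i) (cart (rho i a) k i).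
Proof.
move=> fk ia; have ik : i != k by apply: contraNneq ia => ->; rewrite fk.
have ia' : rho i (rho i a) != rho i a by rewrite rhoK eq_sym.
have no1 b : rho i b != b -> cart b i k = 1%N -> cart b k i <> 1%N.
  by move=> ib c1 c2; have := cart11_iter ik c1 c2; rewrite /= !fk rhoK => /eqP; rewrite (negPf ib).
have e := cart_rho a i k.
case: (edge_fx_cart a i k) (edge_fx_cart (rho i a) i k) => [[f0 h0]|[f0 h0]]; rewrite e.
  by case=> [[_ h0']|[]]; [left | rewrite f0].
case=> [[]|[_ h0']]; first by move=> c0; rewrite c0 in f0.
case: (eqVneq (cart a i k) 1%N) => f1; [right; left | right; right].
  have := no1 _ ia f1; have := no1 _ ia'; rewrite e => /(_ f1).
  by split=> //; lia.
by split=> //; lia.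
Qed.

Definition edge_is i k (b c : nat) := forall a, cart a i k = b /\ cart a k i = c.

Definition zero_edge i k := edge_is i k 0 0.
Definition one_edge i k := edge_is i k 1 1.
Definition double_edge i k := edge_is i k 1 2 \/ edge_is i k 2 1.

Lemma triple112 x y z i i' j : objects x y z -> i != i' ->
  swaps (rho i) x y z -> swaps (rho i') x y z -> swaps (rho j) y z x ->
  one_edge i j /\ zero_edge i i'.
Proof.
move=> O ii' ti ti' tj.
have ij := swaps_neq O ti tj; have i'j := swaps_neq O ti' tj.
have ji' : j != i' by rewrite eq_sym.
have [a1 a2 a3 a4 a5] := cart_swaps_adj O ti tj.
have [_ _ _ b4 b5] := cart_swaps_adj O ti' tj.
have c_gt0 := cart_swaps_gt0 O ti tj; have c_gt0' := cart_swaps_gt0 O ti' tj.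
have [d [d0 dm di dj di']] := root_sums3 ij ii' ji'.
case: O ti ti' tj => xy yz xz H [ix [iy iz]] [ix' [iy' iz']] [jy [jz jx]].
have [u0 w0 v0] := d0 x; have [_ w0' _] := d0 z.
(* The node [i'] exchanges the same objects as [i] but leaves the coordinate at [i] alone, so this
   coordinate is constant; likewise with [i] and [i'] exchanged. *)
have uy : d y i = d x i by rewrite -ix' dm // !inE eqxx !orbT.
have uz : d z i = d x i by rewrite -jy dm // !inE eqxx !orbT.
have vy : d y i' = d x i' by rewrite -ix dm 1?eq_sym // !inE eqxx.
have vz : d z i' = d x i' by rewrite -jy dm 1?eq_sym // !inE eqxx !orbT.
have wy : d y j = d x j by rewrite -ix dm 1?eq_sym // !inE eqxx.
have e1 := di x; have e2 := di z; have e3 := di' x; have e4 := di' z.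
have e5 := dj y; have e6 := dj x.
rewrite ix uy in e1; rewrite iz uz vz in e2; rewrite ix' vy in e3.
rewrite iz' vz uz in e4; rewrite jy uy vy wy in e5; rewrite jx in e6.
rewrite [X in _ = (2 + X)%N]addnC in e3; rewrite [X in _ = (2 + X)%N]addnC in e4.
have [p0 s0] := c_gt0 x; have [_ q0] := c_gt0 y; have [r0 _] := c_gt0 z.
have [p0' s0'] := c_gt0' x; have [_ q0'] := c_gt0' y; have [r0' _] := c_gt0' z.
have [[p1 q1 r1 s1] [l0 l0']] := entries_112 u0 v0 w0 w0' p0 q0 r0 s0 p0' q0' r0' s0'
  e1 e2 e3 e4 e5 e6 a1 a2 a3 a4 a5 b4 b5 (edge_fx_cart x i i') (edge_fx_cart z i i').
split=> a.
  case: (H a) => -> //; split=> //; first by rewrite -ix cart_rho.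
  by rewrite -jy cart_rho.
suff c0 : cart a i i' = 0%N by split=> //; apply/eqP; rewrite -cart_eq0 c0.
by case: (H a) => -> //; rewrite -ix cart_rho.
Qed.

Lemma triple12e x y z i j k : objects x y z ->
  swaps (rho i) x y z -> swaps (rho j) y z x -> fixes_all k ->
  (exists a, cart a i k != 0%N) ->
  [/\ one_edge i j, double_edge i k & zero_edge j k].
Proof.
move=> O ti tj fk ck; have ij := swaps_neq O ti tj.
have c_gt0 := cart_swaps_gt0 O ti tj.
have [a1 a2 a3 _ _] := cart_swaps_adj O ti tj.
case: O ti tj => xy yz xz H [ix [iy iz]] [jy [jz jx]].
have ik : i != k by apply: contraNneq xy => e; rewrite -ix e fk.
have jk : j != k by apply: contraNneq yz => e; rewrite -jy e fk.
have [ji ki kj] : [/\ j != i, k != i & k != j] by split; rewrite eq_sym.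
have [d [d0 dm di dj dk]] := root_sums3 ij ik jk.
have [u0 w0 D0] := d0 x; have [u0' _ _] := d0 y; have [_ w0' _] := d0 z.
have uz : d z i = d y i by rewrite -jy dm // !inE eqxx !orbT.
have wy : d y j = d x j by rewrite -ix dm // !inE eqxx.
have Dy : d y k = d x k by rewrite -ix dm // !inE eqxx.
have Dz : d z k = d x k by rewrite -Dy -jy dm // !inE eqxx !orbT.
have e1 := di x; have e2 := di z; have e3 := dj y; have e4 := dj x.
have e5 := dk x; have e6 := dk y; have e7 := dk z.
rewrite ix in e1; rewrite iz uz Dz in e2; rewrite jy wy Dy in e3; rewrite jx in e4.
rewrite fk in e5; rewrite fk wy Dy in e6; rewrite fk uz Dz in e7.
have [p0 s0] := c_gt0 x; have [_ q0] := c_gt0 y; have [r0 _] := c_gt0 z.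
have ixx : rho i x != x by rewrite ix eq_sym.
have jyy : rho j y != y by rewrite jy eq_sym.
have := edge_mv_cart fk ixx; rewrite ix => Ei; have := edge_mv_cart fk jyy; rewrite jy => Ej.
have := entries_12e u0 u0' w0 w0' D0 p0 q0 r0 s0 e1 e2 e3 e4 e5 e6 e7 a1 a2 a3
  Ei (edge_fx_cart z i k) Ej (edge_fx_cart x j k).
have cy : cart y i k = cart x i k by rewrite -ix cart_rho.
have gz : cart z j k = cart y j k by rewrite -jy cart_rho.
case=> [[f0 f0' _ _]|[[p1 q1 r1 s1]]].
  by case: ck => a; case: (H a) => ->; rewrite ?cy ?f0 ?f0'.
case=> [[g0 g0' f0 f0']|[f0 f0' _ _]]; last first.
  by case: ck => a; case: (H a) => ->; rewrite ?cy ?f0 ?f0'.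
have z_jk : zero_edge j k.
  move=> a; suff c0 : cart a j k = 0%N by split=> //; apply/eqP; rewrite -cart_eq0 c0.
  by case: (H a) => -> //; rewrite gz.
have o_ij : one_edge i j.
  move=> a; case: (H a) => -> //; split=> //; first by rewrite -ix cart_rho.
  by rewrite -jy cart_rho.
split=> //.
(* With the edge of [i] and [j] simple and [k] not joined to [j], the equations shrink to those of
   [entries_12e_const]. *)
rewrite p1 mul1n in e1; rewrite r1 mul1n in e2; rewrite q1 g0 mul1n addn0 in e3.
rewrite s1 g0' mul1n addn0 in e4; rewrite (proj2 (z_jk x)) addn0 in e5.
rewrite (proj2 (z_jk y)) addn0 in e6; rewrite (proj2 (z_jk z)) addn0 in e7.
have Ei' : ([/\ cart x i k = 1, 2 <= cart x k i & 2 <= cart y k i] \/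
    [/\ 2 <= cart x i k, 0 < cart x k i & 0 < cart y k i])%N.
  by case: Ei => [[c0]|//]; rewrite c0 in f0.
have le a (b := rho i a) : [/\ cart a i k = 1 -> cart a k i = 2 -> cart b k i <= 2 &
    cart a i k = 2 -> cart a k i = 1 -> cart b k i <= 1]%N.
  have := @cart121_le b i k ik; have := @cart212_le b i k ik.
  by rewrite /b !(fk, rhoK, cart_rho) => h2 h1; split=> c1 c2; [apply: h1 | apply: h2].
have [c1 c3] := le x; have [c2 c4] := le y; rewrite ix in c1 c3; rewrite iy cy in c2 c4.
have h0 : (0 < cart z k i)%N by rewrite lt0n -cart_eq0 -lt0n.
have := entries_12e_const u0 u0' w0 w0' D0 e1 e2 e3 e4 e5 e6 e7 Ei' c1 c2 c3 c4 f0' h0.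
by case=> [] [? ? ? ? ?]; [left | right] => a; case: (H a) => ->; rewrite ?cy.
Qed.

(** * Diagrams given by lower bounds of entries *)

Definition edge_ge i j (b c : nat) := forall a, (b <= cart a i j /\ c <= cart a j i)%N.

(** Pairs a lower bound of an entry in row [p] with the index of its column. *)
Definition nbrs (E : seq (nat * nat * nat * nat)) (p : nat) : seq (nat * nat) :=
  flatten [seq (if e.1.1.1 == p then [:: (e.1.2, e.1.1.2)] else [::]) ++
               (if e.1.1.2 == p then [:: (e.2, e.1.1.1)] else [::]) | e <- E].

Fixpoint edges_ge (i0 : 'I_n) (J : seq 'I_n) (E : seq (nat * nat * nat * nat)) : Prop :=
  if E is (u, v, b, c) :: E' then edge_ge (nth i0 J u) (nth i0 J v) b c /\ edges_ge i0 J E'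
  else True.

(* [(u, v, b, c)] in [E] stands for an edge between the [u]-th and the [v]-th
   node of [J] with entries at least [b] and [c]. *)
Lemma finite_diagram (a0 : A) i0 (J : seq 'I_n) (E : seq (nat * nat * nat * nat)) :
  uniq J ->
  all (fun p => uniq (p :: map snd (nbrs E p)) &&
    all (fun t => t.2 < size J)%N (nbrs E p)) (iota 0 (size J)) ->
  edges_ge i0 J E ->
  exists D : nat -> nat, forall p, (p < size J)%N ->
    (\sum_(t <- nbrs E p) t.1 * D t.2 < 2 * D p)%N.
Proof.
move=> uJ wf JE; have [D HD] := min_cartan_finite a0.
exists (fun p => D (nth i0 J p)) => p pJ.
have := allP wf p; rewrite mem_iota add0n pJ => /(_ isT) /andP[u_p /allP lt_p].
have := HD (nth i0 J p) [seq (t.1, nth i0 J t.2) | t <- nbrs E p].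
rewrite big_map /=; apply.
  rewrite -map_comp (map_comp (nth i0 J) snd).
  have -> : (nth i0 J p \notin [seq nth i0 J i | i <- map snd (nbrs E p)]) &&
      uniq [seq nth i0 J i | i <- map snd (nbrs E p)] =
      uniq (map (nth i0 J) (p :: map snd (nbrs E p))) by [].
  rewrite map_inj_in_uniq // => u v u_in v_in /eqP.
  have ltJ w : w \in p :: map snd (nbrs E p) -> (w < size J)%N.
    by rewrite inE => /orP[/eqP -> //|/mapP[t /lt_p ? ->]].
  by rewrite nth_uniq ?ltJ // => /eqP.
move=> _ /mapP[t tE ->] a /=.
elim: E JE tE {wf u_p lt_p} => [//|[[[u v] b] c] E IH] /= [e /IH {}IH].
rewrite mem_cat mem_cat => /orP[/orP[]|/IH //].
  by case: eqP => //= <-; rewrite inE => /eqP ->; case: (e a).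
by case: eqP => //= <-; rewrite inE => /eqP ->; case: (e a).
Qed.

Lemma one_edge_ge i j : one_edge i j -> edge_ge i j 1 1.
Proof. by move=> e a; case: (e a) => -> ->. Qed.

Lemma double_edge_ge i j : double_edge i j -> edge_ge i j 1 2 \/ edge_ge i j 2 1.
Proof. by case=> e; [left | right] => a; case: (e a) => -> ->. Qed.

Lemma edge_geC i j b c : edge_ge i j b c -> edge_ge j i c b.
Proof. by move=> e a; case: (e a). Qed.

(** A nonempty set of nodes closed under neighbours at a single object is everything, by
    [cart_connected]. *)
Lemma all_nodes a s0 (S : seq 'I_n) : s0 \in S ->
  (forall l m, l \in S -> m \notin S -> cart a l m != 0%N -> False) ->
  forall m, m \in S.
Proof.
move=> s0S c0 m; apply: contraT => mS; exfalso.
have [||l [k []]] := @cart_connected a [set l in S].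
- by apply/set0Pn; exists s0; rewrite inE.
- by apply/set0Pn; exists m; rewrite !inE.
by rewrite !inE => lS kS; apply: c0.
Qed.

Lemma zero_or_not i k : zero_edge i k \/ exists a, cart a i k != 0%N.
Proof.
case: (classic (exists a, cart a i k != 0%N)) => [|n0]; [by right | left => a].
have c0 : cart a i k = 0%N by apply/eqP; apply: contra_notT n0; exists a.
by split=> //; apply/eqP; rewrite -cart_eq0 c0.
Qed.

Lemma triple12e_rev x y z i j k : objects x y z ->
  swaps (rho i) x y z -> swaps (rho j) y z x -> fixes_all k ->
  (exists a, cart a j k != 0%N) ->
  [/\ one_edge i j, double_edge j k & zero_edge i k].
Proof.
move=> O ti tj fk cjk.
have [e d z0] := triple12e (objects_rev O) (swaps_sym tj) (swaps_sym ti) fk cjk.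
by split=> // a; case: (e a).
Qed.

(** Row [m] is unchanged by the unjoined nodes [i] and [j], and these connect all three objects. *)
Lemma const_row x y z i j m : objects x y z ->
  swaps (rho i) x y z -> swaps (rho j) y z x -> fixes_all m ->
  zero_edge i m -> zero_edge j m -> forall a l, cart a m l = cart x m l.
Proof.
move=> O ti tj fm zi zj.
case: O ti tj => xy yz xz H [ix [iy iz]] [jy [jz jx]].
have im : i != m by apply: contraNneq xy => e; rewrite -ix e fm.
have jm : j != m by apply: contraNneq yz => e; rewrite -jy e fm.
have ey l : cart y m l = cart x m l by rewrite -ix (cart0_row l im) //; case: (zi x).
have ez l : cart z m l = cart x m l by rewrite -ey -jy (cart0_row l jm) //; case: (zj y).
by move=> a l; case: (H a) => ->.
Qed.

Lemma const_row_edge_ge x y z i j m l : objects x y z ->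
  swaps (rho i) x y z -> swaps (rho j) y z x -> fixes_all m ->
  zero_edge i m -> zero_edge j m -> cart x l m != 0%N -> edge_ge l m 1 1.
Proof.
move=> O ti tj fm zi zj; rewrite cart_eq0 -lt0n => c0 a.
have ca : (0 < cart a m l)%N by rewrite (const_row O ti tj fm zi zj).
by split=> //; rewrite lt0n cart_eq0 -lt0n.
Qed.

(** * Exclusion of larger diagrams *)

Section Nodes.

Variables x y z : A.
Hypothesis O : objects x y z.
Hypothesis node_type : forall k,
  [\/ swaps (rho k) x y z, swaps (rho k) y z x | fixes_all k].

Local Notation T1 k := (swaps (rho k) x y z).
Local Notation T2 k := (swaps (rho k) y z x).

Lemma fixes_neq1 i k : T1 i -> fixes_all k -> i != k.
Proof. by case: O => xy _ _ _ [ix _] fk; apply: contraNneq xy => e; rewrite -ix e fk. Qed.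

Lemma fixes_neq2 j k : T2 j -> fixes_all k -> j != k.
Proof. by case: O => _ yz _ _ [jy _] fk; apply: contraNneq yz => e; rewrite -jy e fk. Qed.

Lemma swaps_edge_ge i j : T1 i -> T2 j -> edge_ge i j 1 1.
Proof. by move=> ti tj a; have := cart_swaps_gt0 O ti tj a. Qed.

Ltac node_neq :=
  first [ assumption | exact: (swaps_neq O) | exact: fixes_neq1 | exact: fixes_neq2 ].

Ltac nodes_uniq := rewrite /= !inE !negb_or ?andbT; repeat (apply/andP; split);
  first [ node_neq | rewrite eq_sym; node_neq ].

Ltac edge_lower_bound := first [ exact: I | assumption | exact: swaps_edge_ge
  | apply: edge_geC; first [ assumption | exact: swaps_edge_ge ] ].

(** Refutes the edges [E] on the nodes [J]: the strict inequalities of [finite_diagram], one per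
    node, have no solution once an affine diagram is contained. *)
Ltac no_diagram J E :=
  let i0 := match J with ?h :: _ => h end in
  let U := fresh "U" in let V := fresh "V" in
  let D := fresh "D" in let HD := fresh "HD" in
  exfalso; assert (U : uniq J); [ nodes_uniq | ];
  assert (V : edges_ge i0 J E);
    [ rewrite /=; repeat (refine (conj _ _)); edge_lower_bound | ];
  destruct (@finite_diagram x i0 J E U isT V) as [D HD];
  move: (HD 0%N isT) (HD 1%N isT) (HD 2%N isT) (HD 3%N isT);
  try move: (HD 4%N isT);
  rewrite /nbrs /= !big_cons !big_nil /=; lia.

(** The four nodes would form a cycle, the affine diagram of type A3. *)
Lemma no_square i i' j j' : T1 i -> T1 i' -> T2 j -> T2 j' -> i != i' -> j = j'.
Proof.
move=> ti ti' tj tj' ii'; apply/eqP; apply: contraT => jj'.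
no_diagram [:: i; i'; j; j']
  [:: (0, 2, 1, 1); (0, 3, 1, 1); (1, 2, 1, 1); (1, 3, 1, 1)]%N.
Qed.

Lemma double_edge1 i j k : T1 i -> T2 j -> fixes_all k ->
  zero_edge i k \/ zero_edge j k /\ (edge_ge i k 1 2 \/ edge_ge i k 2 1).
Proof.
move=> ti tj fk; case: (zero_or_not i k) => [|cik]; first by left.
by have [_ /double_edge_ge d z0] := triple12e O ti tj fk cik; right.
Qed.

Lemma double_edge2 i j k : T1 i -> T2 j -> fixes_all k ->
  zero_edge j k \/ zero_edge i k /\ (edge_ge j k 1 2 \/ edge_ge j k 2 1).
Proof.
move=> ti tj fk; case: (zero_or_not j k) => [|cjk]; first by left.
by have [_ /double_edge_ge d z0] := triple12e_rev O ti tj fk cjk; right.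
Qed.

(** Two simple edges and a double edge at [j] form the affine diagram of type B3 or its dual. *)
Lemma no_double_center i i' j k : T1 i -> T1 i' -> T2 j -> i != i' ->
  fixes_all k -> zero_edge j k.
Proof.
move=> ti ti' tj ii' fk; case: (double_edge2 ti tj fk) => [//|[_ [d|d]]].
  no_diagram [:: i; i'; j; k] [:: (0, 2, 1, 1); (1, 2, 1, 1); (2, 3, 1, 2)]%N.
no_diagram [:: i; i'; j; k] [:: (0, 2, 1, 1); (1, 2, 1, 1); (2, 3, 2, 1)]%N.
Qed.

Lemma no_two_double i i' j k : T1 i -> T1 i' -> T2 j -> i != i' ->
  fixes_all k -> (exists a, cart a i k != 0%N) -> zero_edge i' k.
Proof.
move=> ti ti' tj ii' fk [a ca].
case: (double_edge1 ti tj fk) => [/(_ a) [c0]|[_ d]]; first by rewrite c0 in ca.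
case: (double_edge1 ti' tj fk) => [//|[_ d']].
case: d => d; case: d' => d'.
- no_diagram [:: i; i'; j; k] [:: (0, 2, 1, 1); (1, 2, 1, 1); (0, 3, 1, 2); (1, 3, 1, 2)]%N.
- no_diagram [:: i; i'; j; k] [:: (0, 2, 1, 1); (1, 2, 1, 1); (0, 3, 1, 2); (1, 3, 2, 1)]%N.
- no_diagram [:: i; i'; j; k] [:: (0, 2, 1, 1); (1, 2, 1, 1); (0, 3, 2, 1); (1, 3, 1, 2)]%N.
- no_diagram [:: i; i'; j; k] [:: (0, 2, 1, 1); (1, 2, 1, 1); (0, 3, 2, 1); (1, 3, 2, 1)]%N.
Qed.

(** A fifth node would be a fourth neighbour of [j] (affine D4), close a cycle, or be attached to an
    arm by a double edge (affine B4 or its dual). *)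
Lemma nodes_D4 i1 i2 i3 j : T1 i1 -> T1 i2 -> T1 i3 -> T2 j ->
  i1 != i2 -> i1 != i3 -> i2 != i3 -> forall m, m \in [:: j; i1; i2; i3].
Proof.
move=> t1 t2 t3 tj i12 i13 i23; apply: (@all_nodes x j) => [|l m lS]; first exact: mem_head.
rewrite !inE !negb_or => /and4P[mj m1 m2 m3] /eqP clm.
case: (node_type m) => [tm|tm|fm].
- no_diagram [:: j; i1; i2; i3; m]
    [:: (0, 1, 1, 1); (0, 2, 1, 1); (0, 3, 1, 1); (0, 4, 1, 1)]%N.
- by have e := no_square t1 t2 tj tm i12; rewrite e eqxx in mj.
have zjm := no_double_center t1 t2 tj i12 fm.
move: lS; rewrite !inE => /or4P[] /eqP el; rewrite {}el in clm.
- by apply: clm; case: (zjm x).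
- case: (double_edge1 t1 tj fm) => [z1|[_ [d|d]]]; first by apply: clm; case: (z1 x).
    no_diagram [:: j; i1; i2; i3; m]
      [:: (0, 1, 1, 1); (0, 2, 1, 1); (0, 3, 1, 1); (1, 4, 1, 2)]%N.
  no_diagram [:: j; i1; i2; i3; m]
    [:: (0, 1, 1, 1); (0, 2, 1, 1); (0, 3, 1, 1); (1, 4, 2, 1)]%N.
- case: (double_edge1 t2 tj fm) => [z1|[_ [d|d]]]; first by apply: clm; case: (z1 x).
    no_diagram [:: j; i1; i2; i3; m]
      [:: (0, 1, 1, 1); (0, 2, 1, 1); (0, 3, 1, 1); (2, 4, 1, 2)]%N.
  no_diagram [:: j; i1; i2; i3; m]
    [:: (0, 1, 1, 1); (0, 2, 1, 1); (0, 3, 1, 1); (2, 4, 2, 1)]%N.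
- case: (double_edge1 t3 tj fm) => [z1|[_ [d|d]]]; first by apply: clm; case: (z1 x).
    no_diagram [:: j; i1; i2; i3; m]
      [:: (0, 1, 1, 1); (0, 2, 1, 1); (0, 3, 1, 1); (3, 4, 1, 2)]%N.
  no_diagram [:: j; i1; i2; i3; m]
    [:: (0, 1, 1, 1); (0, 2, 1, 1); (0, 3, 1, 1); (3, 4, 2, 1)]%N.
Qed.

Lemma attached_double i j k : T1 i -> T2 j -> fixes_all k ->
  (exists a, cart a i k != 0%N) -> edge_ge i k 1 2 \/ edge_ge i k 2 1.
Proof.
move=> ti tj fk [a ca]; case: (double_edge1 ti tj fk) => [/(_ a) [c0]|[]//].
by rewrite c0 in ca.
Qed.

(** A fifth node is excluded by its position: at [j] as in affine B4, at [i] or [i'] by a second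
    double edge, at [k] as in affine F4, up to the direction of double edges. *)
Lemma nodes_BC4 i i' j k : T1 i -> T1 i' -> T2 j -> fixes_all k -> i != i' ->
  (exists a, cart a i k != 0%N) -> forall m, m \in [:: k; j; i; i'].
Proof.
move=> ti ti' tj fk ii' cik; apply: (@all_nodes x j) => [|l m lS].
  by rewrite !inE eqxx orbT.
rewrite !inE !negb_or => /and4P[mk mj mi mi'] /eqP clm.
have dik := attached_double ti tj fk cik.
case: (node_type m) => [tm|tm|fm].
- case: dik => d.
    no_diagram [:: j; i; i'; m; k] [:: (0, 1, 1, 1); (0, 2, 1, 1); (0, 3, 1, 1); (1, 4, 1, 2)]%N.
  no_diagram [:: j; i; i'; m; k] [:: (0, 1, 1, 1); (0, 2, 1, 1); (0, 3, 1, 1); (1, 4, 2, 1)]%N.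
- by have e := no_square ti ti' tj tm ii'; rewrite e eqxx in mj.
have zjm := no_double_center ti ti' tj ii' fm.
case: (double_edge1 ti tj fm) => [zim|[_ d']]; last first.
  case: dik => d; case: d' => d'.
  - no_diagram [:: j; i; i'; k; m] [:: (0, 1, 1, 1); (0, 2, 1, 1); (1, 3, 1, 2); (1, 4, 1, 2)]%N.
  - no_diagram [:: j; i; i'; k; m] [:: (0, 1, 1, 1); (0, 2, 1, 1); (1, 3, 1, 2); (1, 4, 2, 1)]%N.
  - no_diagram [:: j; i; i'; k; m] [:: (0, 1, 1, 1); (0, 2, 1, 1); (1, 3, 2, 1); (1, 4, 1, 2)]%N.
  - no_diagram [:: j; i; i'; k; m] [:: (0, 1, 1, 1); (0, 2, 1, 1); (1, 3, 2, 1); (1, 4, 2, 1)]%N.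
case: (double_edge1 ti' tj fm) => [zi'm|[_ d']]; last first.
  case: dik => d; case: d' => d'.
  - no_diagram [:: j; i; i'; k; m] [:: (0, 1, 1, 1); (0, 2, 1, 1); (1, 3, 1, 2); (2, 4, 1, 2)]%N.
  - no_diagram [:: j; i; i'; k; m] [:: (0, 1, 1, 1); (0, 2, 1, 1); (1, 3, 1, 2); (2, 4, 2, 1)]%N.
  - no_diagram [:: j; i; i'; k; m] [:: (0, 1, 1, 1); (0, 2, 1, 1); (1, 3, 2, 1); (2, 4, 1, 2)]%N.
  - no_diagram [:: j; i; i'; k; m] [:: (0, 1, 1, 1); (0, 2, 1, 1); (1, 3, 2, 1); (2, 4, 2, 1)]%N.
move: lS; rewrite !inE => /or4P[] /eqP el; rewrite {}el in clm.
- have /eqP ckm := clm; have e := const_row_edge_ge O ti tj fm zim zjm ckm.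
  case: dik => d.
    no_diagram [:: j; i; i'; k; m] [:: (0, 1, 1, 1); (0, 2, 1, 1); (1, 3, 1, 2); (3, 4, 1, 1)]%N.
  no_diagram [:: j; i; i'; k; m] [:: (0, 1, 1, 1); (0, 2, 1, 1); (1, 3, 2, 1); (3, 4, 1, 1)]%N.
- by apply: clm; case: (zjm x).
- by apply: clm; case: (zim x).
- by apply: clm; case: (zi'm x).
Qed.

(** Otherwise there are two double edges, adjacent or at both ends of a chain, which is affine. *)
Lemma second_fixing_node i j k m : T1 i -> T2 j -> fixes_all k -> fixes_all m ->
  k != m -> (exists a, cart a i k != 0%N) -> zero_edge i m /\ zero_edge j m.
Proof.
move=> ti tj fk fm km cik; have dik := attached_double ti tj fk cik.
split.
  case: (double_edge1 ti tj fm) => [//|[_ d']].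
  case: dik => d; case: d' => d'.
  - no_diagram [:: i; j; k; m] [:: (0, 1, 1, 1); (0, 2, 1, 2); (0, 3, 1, 2)]%N.
  - no_diagram [:: i; j; k; m] [:: (0, 1, 1, 1); (0, 2, 1, 2); (0, 3, 2, 1)]%N.
  - no_diagram [:: i; j; k; m] [:: (0, 1, 1, 1); (0, 2, 2, 1); (0, 3, 1, 2)]%N.
  - no_diagram [:: i; j; k; m] [:: (0, 1, 1, 1); (0, 2, 2, 1); (0, 3, 2, 1)]%N.
case: (double_edge2 ti tj fm) => [//|[_ d']].
case: dik => d; case: d' => d'.
- no_diagram [:: i; j; k; m] [:: (0, 1, 1, 1); (0, 2, 1, 2); (1, 3, 1, 2)]%N.
- no_diagram [:: i; j; k; m] [:: (0, 1, 1, 1); (0, 2, 1, 2); (1, 3, 2, 1)]%N.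
- no_diagram [:: i; j; k; m] [:: (0, 1, 1, 1); (0, 2, 2, 1); (1, 3, 1, 2)]%N.
- no_diagram [:: i; j; k; m] [:: (0, 1, 1, 1); (0, 2, 2, 1); (1, 3, 2, 1)]%N.
Qed.

(** The averaged criterion controls only minima of entries over the objects. The exact entries at
    all objects need the root sums of the four nodes. *)
Lemma F4_end_edge i j k m : T1 i -> T2 j -> fixes_all k -> fixes_all m ->
  k != m -> (exists a, cart a i k != 0%N) -> cart x k m != 0%N -> one_edge k m.
Proof.
move=> ti tj fk fm km cik ckm.
have [zim zjm] := second_fixing_node ti tj fk fm km cik.
have [oij dik zjk] := triple12e O ti tj fk cik.
have ckm_gt0 := const_row_edge_ge O ti tj fm zim zjm ckm.
have row_m := const_row O ti tj fm zim zjm.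
have U : uniq [:: i; j; k; m] by nodes_uniq.
have [d [d0 dm de]] := root_sums_seq U.
have ij := swaps_neq O ti tj; have ik := fixes_neq1 ti fk; have im := fixes_neq1 ti fm.
have jk := fixes_neq2 tj fk; have jm := fixes_neq2 tj fm.
have [mi mj mk] : [/\ i \in [:: i; j; k; m], j \in [:: i; j; k; m] & k \in [:: i; j; k; m]].
  by rewrite !inE !eqxx !orbT.
have mm : m \in [:: i; j; k; m] by rewrite !inE eqxx !orbT.
have eqs a : [/\ d a i + d (rho i a) i = 2 + (d a j + cart a i k * d a k),
    d a j + d (rho j a) j = 2 + d a i,
    d a k + d a k = 2 + (cart a k i * d a i + cart a k m * d a m) &
    d a m + d a m = 2 + cart x m k * d a k]%N.
  have := de a i mi; have := de a j mj; have := de a k mk; have := de a m mm.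
  rewrite !big_cons !big_nil !eqxx !(eq_sym j i) !(eq_sym k i) !(eq_sym m i).
  rewrite !(eq_sym k j) !(eq_sym m j) (eq_sym m k) ij ik im jk jm km /=.
  rewrite !(proj1 (oij a)) !(proj2 (oij a)) !(proj1 (zjk a)) !(proj2 (zjk a)).
  rewrite !(proj1 (zim a)) !(proj2 (zim a)) !(proj1 (zjm a)) !(proj2 (zjm a)).
  rewrite !fk !fm !row_m !mul1n !mul0n !add0n !addn0 => em ek ej ei.
  by split; rewrite ?em ?ek ?ej ?ei.
case: (O) (ti) (tj) => xy yz xz H [ix [iy iz]] [jy [jz jx]].
have uz : d z i = d y i by rewrite -jy dm.
have wy : d y j = d x j by rewrite -ix dm // eq_sym.
have [Dy My] : d y k = d x k /\ d y m = d x m by rewrite -ix !dm // eq_sym.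
have [Dz Mz] : d z k = d x k /\ d z m = d x m by rewrite -Dy -My -jy !dm // eq_sym.
have [e1 e4 e5 e8] := eqs x; have [_ e3 e6 _] := eqs y; have [e2 _ e7 _] := eqs z.
have [f [h [fh fE]]] : exists f h, (f = 1 /\ h = 2 \/ f = 2 /\ h = 1)%N /\
    forall a, cart a i k = f /\ cart a k i = h.
  by case: dik => e; [exists 1%N, 2%N | exists 2%N, 1%N]; split=> //; [left | right].
rewrite ix (proj1 (fE x)) in e1; rewrite iz uz Dz (proj1 (fE z)) in e2.
rewrite jy wy in e3; rewrite jx in e4.
rewrite (proj2 (fE x)) in e5; rewrite Dy My (proj2 (fE y)) in e6.
rewrite Dz Mz uz (proj2 (fE z)) in e7.
have [g1 g2 g3 t1] := entries_12ee (d0 x i mi) (d0 y i mi) (d0 x j mj) (d0 z j mj) (d0 x k mk)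
  (d0 x m mm) e1 e2 e3 e4 e5 e6 e7 e8 fh (proj1 (ckm_gt0 x)) (proj1 (ckm_gt0 y))
  (proj1 (ckm_gt0 z)) (proj2 (ckm_gt0 x)).
by move=> a; rewrite row_m t1; case: (H a) => ->.
Qed.

(** A further node fixes all objects and can only meet [m], giving a chain as in affine F4, or [k],
    giving a fork as in affine B3, up to direction. *)
Lemma nodes_F4 i j k m : T1 i -> T2 j -> fixes_all k -> fixes_all m ->
  k != m -> (exists a, cart a i k != 0%N) -> cart x k m != 0%N ->
  (forall l, T1 l -> l = i) -> (forall l, T2 l -> l = j) ->
  forall l, l \in [:: m; k; i; j].
Proof.
move=> ti tj fk fm km cik ckm only1 only2; apply: (@all_nodes x i) => [|l m' lS].
  by rewrite !inE eqxx !orbT.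
rewrite !inE !negb_or => /and4P[m'm m'k m'i m'j] /eqP clm.
have e := one_edge_ge (F4_end_edge ti tj fk fm km cik ckm).
have dik := attached_double ti tj fk cik.
case: (node_type m') => [/only1 e1|/only2 e1|fm']; try by rewrite e1 eqxx in m'i m'j.
have [zi zj] : zero_edge i m' /\ zero_edge j m'.
  by apply: second_fixing_node cik => //; rewrite eq_sym.
move: lS; rewrite !inE => /or4P[] /eqP el; rewrite {}el in clm.
- have /eqP clm' := clm; have e' := const_row_edge_ge O ti tj fm' zi zj clm'.
  case: dik => d.
    no_diagram [:: i; j; k; m; m'] [:: (0, 1, 1, 1); (0, 2, 1, 2); (2, 3, 1, 1); (3, 4, 1, 1)]%N.
  no_diagram [:: i; j; k; m; m'] [:: (0, 1, 1, 1); (0, 2, 2, 1); (2, 3, 1, 1); (3, 4, 1, 1)]%N.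
- have /eqP clm' := clm; have e' := const_row_edge_ge O ti tj fm' zi zj clm'.
  case: dik => d.
    no_diagram [:: i; j; k; m; m'] [:: (0, 1, 1, 1); (0, 2, 1, 2); (2, 3, 1, 1); (2, 4, 1, 1)]%N.
  no_diagram [:: i; j; k; m; m'] [:: (0, 1, 1, 1); (0, 2, 2, 1); (2, 3, 1, 1); (2, 4, 1, 1)]%N.
- by apply: clm; case: (zi x).
- by apply: clm; case: (zj x).
Qed.

End Nodes.

(** * Assembling the classification *)

(** Nodes with distinct transpositions are joined, so all three transpositions would give a
    triangle, affine A2. *)
Lemma no_three_swaps x y z i j k : objects x y z ->
  swaps (rho i) x y z -> swaps (rho j) y z x -> ~ swaps (rho k) x z y.
Proof.
move=> O ti tj tk.
have O' := objects_swap O; have O'' := objects_swap (objects_rev O).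
have cij := cart_swaps_gt0 O ti tj; have ij := swaps_neq O ti tj.
have cik := cart_swaps_gt0 O' (swaps_sym ti) tk; have ik := swaps_neq O' (swaps_sym ti) tk.
have cjk := cart_swaps_gt0 O'' tj (swaps_sym tk); have jk := swaps_neq O'' tj (swaps_sym tk).
have U : uniq [:: i; j; k] by rewrite /= !inE negb_or ij ik jk.
have [D HD] := @finite_diagram x i [:: i; j; k]
  [:: (0, 1, 1, 1); (0, 2, 1, 1); (1, 2, 1, 1)]%N U isT (conj cij (conj cik (conj cjk I))).
have := HD 0%N isT; have := HD 1%N isT; have := HD 2%N isT.
rewrite /nbrs /= !big_cons !big_nil /=; lia.
Qed.

Lemma exists_neighbor a s0 (S : seq 'I_n) : s0 \in S -> (size S < n)%N ->
  exists l m, [/\ l \in S, m \notin S & cart a l m != 0%N].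
Proof.
move=> s0S ltSn; apply: NNPP => nex.
have allS : forall m, m \in S.
  by apply: (@all_nodes a s0) => // l m lS mS clm; apply: nex; exists l, m.
have := @uniq_leq_size _ (enum 'I_n) S (enum_uniq _) (fun m _ => allS m).
by rewrite size_enum_ord leqNgt ltSn.
Qed.

Lemma edge_isC i j b c : edge_is i j b c -> edge_is j i c b.
Proof. by move=> e a; case: (e a). Qed.

(** Rebuilds the Cartan matrices from the six edges of four nodes. The boolean hypothesis says that
    [c] has 2 on the diagonal and no positive entry elsewhere. *)
Lemma cartan4 s0 s1 s2 s3 (c : nat -> nat -> int) :
  let b u v := absz (c u v) in
  all (fun u => all (fun v => c u v == if u == v then 2 else - (b u v)%:Z) (iota 0 4)) (iota 0 4) ->
  uniq [:: s0; s1; s2; s3] ->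
  edge_is s0 s1 (b 0 1)%N (b 1 0)%N -> edge_is s0 s2 (b 0 2)%N (b 2 0)%N ->
  edge_is s0 s3 (b 0 3)%N (b 3 0)%N -> edge_is s1 s2 (b 1 2)%N (b 2 1)%N ->
  edge_is s1 s3 (b 1 3)%N (b 3 1)%N -> edge_is s2 s3 (b 2 3)%N (b 3 2)%N ->
  forall a (i j : 'I_4),
    C a (tnth [tuple s0; s1; s2; s3] i) (tnth [tuple s0; s1; s2; s3] j) = c i j.
Proof.
move=> b /= cb; rewrite !inE !negb_or => /and4P[/and3P[n01 n02 n03] /andP[n12 n13] n23 _].
move=> e01 e02 e03 e12 e13 e23 a i j.
move: cb; rewrite !andbT -!andbA.
do 15![case/andP => /eqP ?]; move/eqP => ?.
have [n10 n20 n30] : [/\ s1 != s0, s2 != s0 & s3 != s0] by split; rewrite eq_sym.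
have [n21 n31 n32] : [/\ s2 != s1, s3 != s1 & s3 != s2] by split; rewrite eq_sym.
case: (e01 a) (e02 a) (e03 a) (e12 a) (e13 a) (e23 a)
  => [? ?] [? ?] [? ?] [? ?] [? ?] [? ?].
case: i j => [[|[|[|[|u]]]] hu] [[|[|[|[|v]]]] hv] //; rewrite !(tnth_nth s0) /=;
  rewrite ?C_diag ?C_cart //.
all: congruence.
Qed.

Definition classified (s0 s1 s2 s3 : 'I_n) (c : nat -> nat -> int) (x y z : A) :=
  [/\ uniq [:: s0; s1; s2; s3], forall k, k \in [:: s0; s1; s2; s3], objects x y z,
      forall a (i j : 'I_4),
        C a (tnth [tuple s0; s1; s2; s3] i) (tnth [tuple s0; s1; s2; s3] j) = c i j &
  [\/ [/\ c = cmB4 \/ c = cmC4, swaps (rho s0) x y z, swaps (rho s2) x y z,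
         swaps (rho s1) y z x & fixes_all s3],
      [/\ c = cmD4, swaps (rho s0) x y z, swaps (rho s2) x y z,
         swaps (rho s3) x y z & swaps (rho s1) y z x] |
      [/\ c = cmF4 \/ c = cmF4', swaps (rho s0) x y z, swaps (rho s1) y z x,
         fixes_all s2 & fixes_all s3]]].

Definition is_classified := exists s0 s1 s2 s3 c x y z, classified s0 s1 s2 s3 c x y z.

Hypothesis n_ge4 : (4 <= n)%N.

Definition node_types x y z := forall k,
  [\/ swaps (rho k) x y z, swaps (rho k) y z x | fixes_all k].

Lemma node_types_rev x y z : node_types x y z -> node_types z y x.
Proof.
move=> H k; case: (H k) => [/swaps_sym|/swaps_sym|] t;
  by [constructor 2 | constructor 1 | constructor 3].
Qed.

Lemma classified_two_swaps x y z i i' j : objects x y z -> node_types x y z ->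
  swaps (rho i) x y z -> swaps (rho i') x y z -> i != i' -> swaps (rho j) y z x ->
  is_classified.
Proof.
move=> O N ti ti' ii' tj.
have i'i : i' != i by rewrite eq_sym.
have [oij zii'] := triple112 O ii' ti ti' tj.
have [oi'j _] := triple112 O i'i ti' ti tj.
have BC k h h' : fixes_all k -> swaps (rho h) x y z -> swaps (rho h') x y z -> h != h' ->
    one_edge h j -> one_edge h' j -> zero_edge h h' -> cart x h k != 0%N -> is_classified.
  move=> fk th th' hh' oh oh' zhh' chk.
  have chk' : exists a, cart a h k != 0%N by exists x.
  have [_ dhk zjk] := triple12e O th tj fk chk'.
  have zh'k := no_two_double O th th' tj hh' fk chk'.
  have Ns := nodes_BC4 O N th th' tj fk hh' chk'.
  have U : uniq [:: h'; j; h; k].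
    rewrite /= !inE !negb_or (swaps_neq O th' tj) (eq_sym h') hh' (fixes_neq1 O th' fk).
    by rewrite eq_sym (swaps_neq O th tj) (fixes_neq2 O tj fk) (fixes_neq1 O th fk).
  have [c [cE cM]] : exists c, (c = cmB4 \/ c = cmC4) /\ forall a (u v : 'I_4),
      C a (tnth [tuple h'; j; h; k] u) (tnth [tuple h'; j; h; k] v) = c u v.
    case: dhk => dhk; [exists cmB4 | exists cmC4]; (split; first by [left | right]);
      apply: cartan4 => //; exact: edge_isC.
  exists h', j, h, k, c, x, y, z; split=> //; last by constructor 1; split.
  by move=> m; have := Ns m; rewrite !inE => /or4P[] /eqP ->; rewrite eqxx ?orbT.
(* A fourth node is attached to the path [i], [j], [i']; its type decides between D4 and B4 or
   C4. *)
have [l [m [lS]]] := exists_neighbor x (mem_head j [:: i; i']) n_ge4.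
rewrite !inE !negb_or => /and3P[mj mi mi'] clm.
case: (N m) => [tm|tm|fm].
- have [im i'm] : i != m /\ i' != m by rewrite eq_sym mi eq_sym mi'.
  have [_ zim] := triple112 O im ti tm tj; have [_ zi'm] := triple112 O i'm ti' tm tj.
  have [omj _] := triple112 O mi tm ti tj.
  exists i, j, i', m, cmD4, x, y, z.
  have U : uniq [:: i; j; i'; m].
    rewrite /= !inE !negb_or (swaps_neq O ti tj) ii' im (eq_sym j i').
    by rewrite (swaps_neq O ti' tj) (eq_sym j) mj i'm.
  split=> //; last by constructor 2; split.
    move=> k; have := nodes_D4 O N ti ti' tm tj ii' im i'm k.
    by rewrite !inE => /or4P[] /eqP ->; rewrite eqxx ?orbT.
  by apply: cartan4 => //; exact: edge_isC.
- by have e := no_square O ti ti' tj tm ii'; rewrite e eqxx in mj.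
- have zjm := no_double_center O ti ti' tj ii' fm.
  move: lS clm; rewrite !inE => /or3P[] /eqP -> clm.
  + by case: (zjm x) clm => ->.
  + exact: (BC m i i').
  + by apply: (BC m i' i) => // a; case: (zii' a).
Qed.

Lemma classified_F4 x y z i j k : objects x y z -> node_types x y z ->
  swaps (rho i) x y z -> swaps (rho j) y z x -> fixes_all k ->
  (forall l, swaps (rho l) x y z -> l = i) -> (forall l, swaps (rho l) y z x -> l = j) ->
  (exists a, cart a i k != 0%N) -> is_classified.
Proof.
move=> O N ti tj fk only1 only2 cik.
have [oij dik zjk] := triple12e O ti tj fk cik.
have [l [m [lS]]] := exists_neighbor x (mem_head k [:: i; j]) n_ge4.
rewrite !inE !negb_or => /and3P[mk mi mj] clm.
have fm : fixes_all m.
  by case: (N m) => [/only1 e|/only2 e|//]; rewrite e eqxx in mi mj.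
have km : k != m by rewrite eq_sym.
have [zim zjm] := second_fixing_node O ti tj fk fm km cik.
have ckm : cart x k m != 0%N.
  move: lS clm; rewrite !inE => /or3P[] /eqP -> //.
    by case: (zim x) => ->.
  by case: (zjm x) => ->.
have okm := F4_end_edge O ti tj fk fm km cik ckm.
have Ns := nodes_F4 O N ti tj fk fm km cik ckm only1 only2.
have U : uniq [:: j; i; k; m].
  rewrite /= !inE !negb_or (eq_sym j i) (swaps_neq O ti tj) (fixes_neq2 O tj fk).
  by rewrite (fixes_neq2 O tj fm) (fixes_neq1 O ti fk) (fixes_neq1 O ti fm) km.
have [c [cE cM]] : exists c, (c = cmF4 \/ c = cmF4') /\ forall a (u v : 'I_4),
    C a (tnth [tuple j; i; k; m] u) (tnth [tuple j; i; k; m] v) = c u v.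
  case: dik => dik; [exists cmF4 | exists cmF4']; (split; first by [left | right]);
    apply: cartan4 => //; exact: edge_isC.
(* The end node [j] comes first in the chain and exchanges [y] and [z], so the objects are listed in
   reverse. *)
exists j, i, k, m, c, z, y, x; split=> //.
- by move=> h; have := Ns h; rewrite !inE => /or4P[] /eqP ->; rewrite eqxx ?orbT.
- exact: objects_rev.
- by constructor 3; split=> //; apply: swaps_sym.
Qed.

Hypothesis card_A : #|A| = 3%N.

Lemma swaps_intro x y z k : objects x y z -> rho k x = y -> swaps (rho k) x y z.
Proof.
move=> [xy yz xz H] kx; have ky : rho k y = x by rewrite -kx rhoK.
split=> //; split=> //; case: (H (rho k z)) => // e.
  by move: yz; rewrite -[z](rhoK k) e kx eqxx.
by move: xz; rewrite -[z](rhoK k) e ky eqxx.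
Qed.

Lemma moved_object (a : A) : exists k, rho k a != a.
Proof.
apply: NNPP => nk; have fa k : rho k a = a by apply/eqP; apply: contra_notT nk; exists k.
have : (1 < #|A|)%N by rewrite card_A.
case/card_gt1P => b [c [_ _]] /eqP; apply.
have a_only d : d = a.
  by have [w <-] := connC a d; elim: w => //= k w ->.
by rewrite (a_only b) (a_only c).
Qed.

(** Some node moves [x] to an object called [y], and another one moves the third object [z]. If it
    moves [z] to [x], the names [x] and [y] are exchanged. *)
Lemma exists_objects : exists x y z i j,
  [/\ objects x y z, swaps (rho i) x y z & swaps (rho j) y z x].
Proof.
have /card_gt0P [x _] : (0 < #|A|)%N by rewrite card_A.
have [i ix] := moved_object x; set y := rho i x in ix.
have : #|~: [set x; y]| == 1%N.
  by have := cardsC [set x; y]; rewrite cards2 eq_sym ix card_A => /eqP.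
case/cards1P => z zE.
have O : objects x y z.
  have : z \in ~: [set x; y] by rewrite zE inE.
  rewrite !inE negb_or => /andP[zx zy]; split; rewrite 1?eq_sym // => a.
  have /setP/(_ a) := zE; rewrite !inE.
  case: eqP => [->|_]; first by constructor 1.
  by case: eqP => [->|_ /esym/eqP ->]; [constructor 2 | constructor 3].
have ti := swaps_intro O (erefl y).
have [j jz] := moved_object z.
case: (O) => _ _ _ /(_ (rho j z)) [] e.
- exists y, x, z, i, j; split; [exact: objects_swap | exact: swaps_sym |].
  by apply/swaps_sym/swaps_intro => //; apply/objects_rev/objects_swap.
- exists x, y, z, i, j; split=> //; apply/swaps_sym/swaps_intro => //.
  exact: objects_rev.
- by rewrite e eqxx in jz.
Qed.

Lemma exists_classified : is_classified.
Proof.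
have [x [y [z [i [j [O ti tj]]]]]] := exists_objects.
(* An involution of three objects is the identity or a transposition, and the third transposition is
   excluded. *)
have N : node_types x y z.
  move=> k; case: (O) => xy yz xz H; case: (H (rho k x)) => kx.
  - case: (H (rho k y)) => ky.
    + by move: xy; rewrite -[y](rhoK k) ky kx eqxx.
    + constructor 3 => a; case: (H a) => -> //; case: (H (rho k z)) => // kz.
        by move: xz; rewrite -[z](rhoK k) kz kx eqxx.
      by move: yz; rewrite -[z](rhoK k) kz ky eqxx.
    + by constructor 2; apply: swaps_intro ky; apply/objects_swap/objects_rev.
  - by constructor 1; apply: swaps_intro.
  - case: (no_three_swaps O ti tj (k := k)); apply: swaps_intro kx.
    exact/objects_rev/objects_swap/objects_rev.
have O' := objects_rev O; have N' := node_types_rev N.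
case: (classic (exists i', swaps (rho i') x y z /\ i != i')) => [[i' [ti' ii']]|n1].
  exact: classified_two_swaps O N ti ti' ii' tj.
case: (classic (exists j', swaps (rho j') y z x /\ j != j')) => [[j' [tj' jj']]|n2].
  exact: classified_two_swaps O' N' (swaps_sym tj) (swaps_sym tj') jj' (swaps_sym ti).
have only1 l : swaps (rho l) x y z -> l = i.
  by move=> tl; apply/eqP; apply: contra_notT n1 => li; exists l; rewrite eq_sym.
have only2 l : swaps (rho l) y z x -> l = j.
  by move=> tl; apply/eqP; apply: contra_notT n2 => lj; exists l; rewrite eq_sym.
(* With one node for each transposition, a third node fixes all objects. It is joined to [i] or to
   [j], and reversing the objects reduces the second case to the first. *)
have [l [m [lS]]] := exists_neighbor x (mem_head i [:: j]) (ltnW n_ge4).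
rewrite !inE negb_or => /andP[mi mj] clm.
have fm : fixes_all m.
  by case: (N m) => [/only1 e|/only2 e|//]; rewrite e eqxx in mi mj.
move: lS clm; rewrite !inE => /orP[] /eqP -> clm.
  by apply: classified_F4 O N ti tj fm only1 only2 _; exists x.
apply: classified_F4 O' N' (swaps_sym tj) (swaps_sym ti) fm _ _ _; last by exists x.
  by move=> h /swaps_sym /only2.
by move=> h /swaps_sym /only1.
Qed.


End RootSystem.

Theorem theorem6p5 (theta : nat) (A : finType)
  (rho : 'I_theta -> A -> A) (C : A -> 'M[int]_theta)
  (R : A -> 'rV[int]_theta -> Prop) :
  (4 <= theta)%N ->
  #|A| = 3%N ->
  cartan_scheme rho C ->
  connected_scheme rho ->
  root_system rho C R ->
  finite_rs R ->
  irreducible_rs R ->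
  standard_scheme C /\
  (forall a, indecomposable (C a)) /\
  exists (p : 'I_4 -> 'I_theta) (x y z : A),
    bijective p /\ x != y /\ y != z /\ x != z /\
    let c := fun i j : 'I_4 => C x (p i) (p j) in
    let r := fun k : 'I_4 => rho (p k) in
    ( ((forall i j : 'I_4, c i j = cmB4 i j) \/
       (forall i j : 'I_4, c i j = cmC4 i j)) /\
      swaps (r (inord 0)) x y z /\ swaps (r (inord 2)) x y z /\
      swaps (r (inord 1)) y z x /\ (forall a, r (inord 3) a = a) )
    \/
    ( (forall i j : 'I_4, c i j = cmD4 i j) /\
      swaps (r (inord 0)) x y z /\ swaps (r (inord 2)) x y z /\ swaps (r (inord 3)) x y z /\
      swaps (r (inord 1)) y z x )
    \/
    ( ((forall i j : 'I_4, c i j = cmF4 i j) \/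
       (forall i j : 'I_4, c i j = cmF4' i j)) /\
      swaps (r (inord 0)) x y z /\ swaps (r (inord 1)) y z x /\
      (forall a, r (inord 2) a = a) /\ (forall a, r (inord 3) a = a) ).
Proof.
move=> n_ge4 card_A cs conn rs fin irr.
have [s0 [s1 [s2 [s3 [c [x [y [z [U Us [xy yz xz _] cM alt]]]]]]]]] :=
  exists_classified cs rs fin conn irr n_ge4 card_A.
set p := tnth [tuple s0; s1; s2; s3] in cM.
have p_onto k : exists i, k = p i by apply/tnthP; apply: Us.
have p_bij : bijective p.
  apply: inj_card_bij; first by apply/tuple_uniqP.
  rewrite !card_ord -(size_enum_ord theta).
  by apply: (@uniq_leq_size _ _ [:: s0; s1; s2; s3]) => [|k _]; rewrite ?enum_uniq ?Us.
have [p0 p1 p2 p3] : [/\ p (inord 0) = s0, p (inord 1) = s1, p (inord 2) = s2 &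
    p (inord 3) = s3] by rewrite /p !(tnth_nth s0) !inordK.
split=> [a b|].
  apply/matrixP => k l; have [i ->] := p_onto k; have [j ->] := p_onto l.
  by rewrite !cM.
split=> [a [S [S0 [S1 SC]]]|].
  have [k [l [kS lS]]] := cart_connected cs rs fin conn irr a S0 S1.
  by rewrite /cart SC.
exists p, x, y, z; split=> //; do 3![split=> //] => /=.
rewrite !p0 !p1 !p2 !p3.
case: alt => [[[cE|cE] t0 t2 t1 f]|[cE t0 t2 t3 t1]|[[cE|cE] t0 t1 f f']].
- by left; split; [left => i j; rewrite cM cE | split].
- by left; split; [right => i j; rewrite cM cE | split].
- by right; left; split; [move=> i j; rewrite cM cE | split].
- by right; right; split; [left => i j; rewrite cM cE | split].
- by right; right; split; [right => i j; rewrite cM cE | split].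
Qed.
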